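(* Let $K$ be a field and let $w \in S_n$ be a permutation. The matrix Schubert variety $\overline{X}_w$ is a complete intersection if and only if, for every $(p,q) \in D_{>0}(w)$, the matrix $w_{(p,q)}$ is a permutation matrix in $S_{r_{p,q}(w)}$ (i.e. in $GL_{r_{p,q}(w)}$) such that $\overline{X}_{w_{(p,q)}}$ is a complete intersection. In this case, \[ \{ x_{p,q} \mid (p,q) \in D_{=0}(w) \} \sqcup \{ \det \boldsymbol{X}_{\overline{(p,q)}} \mid (p,q) \in D_{>0}(w) \} \] is a set of generators of the ideal $I_w$ with cardinality $|D(w)|$, the codimension of $\overline{X}_w$ in $M_{n\times n}$.
   Context: $M_{n\times n}$ is the space of $n\times n$ matrices over the field $K$, with coordinate ring $K[\boldsymbol{X}]$, the polynomial ring in the entries of the generic matrix $\boldsymbol{X}=(x_{i,j})_{1\le i,j\le n}$. A permutation $w\in S_n$ is identified with the $n\times n$ matrix with $w_{i,j}=1$ if $w(i)=j$ and $w_{i,j}=0$ otherwise. For a matrix $Z$, $Z_{[p,q]}$ denotes its upper-left $p\times q$ submatrix and $r_{p,q}(Z)=\operatorname{rank}(Z_{[p,q]})$; similarly $\boldsymbol{X}_{[p,q]}$ is the upper-left $p\times q$ submatrix of $\boldsymbol{X}$. The matrix Schubert variety is $\overline{X}_w=\{Z\in M_{n\times n}\mid r_{p,q}(Z)\le r_{p,q}(w)\text{ for all }p,q\}$. Its defining ideal $I_w\subseteq K[\boldsymbol{X}]$ (the Schubert determinantal ideal) is generated by all minors of size $r_{p,q}(w)+1$ in $\boldsymbol{X}_{[p,q]}$,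 for all $p,q$. The diagram of $w$ is $D(w)=\{(i,j)\in[1,n]\times[1,n] : w(i)>j\text{ and }w^{-1}(j)>i\}$. The codimension of $\overline{X}_w$ in $M_{n\times n}$ is $|D(w)|$, and $\overline{X}_w$ is a complete intersection if and only if $I_w$ can be generated by $|D(w)|$ elements. Put $D_{=0}(w)=\{(p,q)\in D(w)\mid r_{p,q}(w)=0\}$ and $D_{>0}(w)=\{(p,q)\in D(w)\mid r_{p,q}(w)>0\}$. For $(p,q)\in D_{>0}(w)$ and $r=r_{p,q}(w)$: $w_{(p,q)}$ is the $r\times r$ submatrix of $w$ on rows $p-r,\dots,p-1$ and columns $q-r,\dots,q-1$; $\boldsymbol{X}_{\overline{(p,q)}}$ is the $(r+1)\times(r+1)$ submatrix of $\boldsymbol{X}$ on rows $p-r,\dots,p$ and columns $q-r,\dots,q$. *)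

(* Defs.v *)
From mathcomp Require Import all_boot all_order all_fingroup all_algebra.
From mathcomp Require Import finmap mpoly.

Set Implicit Arguments.
Unset Strict Implicit.
Unset Printing Implicit Defensive.

Import GRing.Theory.
Local Open Scope ring_scope.

(* Rows and columns are numbered from 0, so the box (i, j) : 'I_n * 'I_n is
   the box (p, q) = (i + 1, j + 1) of the usual 1-based convention, and
   Z_[p,q] has i.+1 rows and j.+1 columns. *)

Section Ideals.
Variable R : comNzRingType.

Definition ideal_gen (S : R -> Prop) (f : R) : Prop :=
  exists s : seq (R * R),
    (forall t, t \in s -> S t.2) /\ f = \sum_(t <- s) t.1 * t.2.

Definition generates (S I : R -> Prop) : Prop :=
  forall f, I f <-> ideal_gen S f.

(* Repetitions are allowed in gs, so this says "at most k generators". *)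
Definition generated_by (k : nat) (I : R -> Prop) : Prop :=
  exists gs : k.-tuple R, generates (fun g => g \in gs) I.

Definition prime_ideal (P : {pred R}) : Prop :=
  idealr_closed P /\ prime_idealr_closed P.

(* Strict chains P_0 < ... < P_d of d + 1 primes of R containing I; the values
   P k for k > d are irrelevant. *)
Definition prime_chain (I : R -> Prop) (d : nat) : Prop :=
  exists P : nat -> {pred R},
    (forall k, (k <= d)%N -> prime_ideal (P k) /\ forall f, I f -> f \in P k) /\
    (forall k, (k < d)%N ->
       {subset P k <= P k.+1} /\ exists2 f, f \in P k.+1 & f \notin P k).

(* The Krull dimension of R / I is d. *)
Definition krull_dim (I : R -> Prop) (d : nat) : Prop :=
  prime_chain I d /\ forall e, prime_chain I e -> (e <= d)%N.

(* The closed subscheme of Spec R defined by I has dimension dim R - c. *)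
Definition has_codim (I : R -> Prop) (c : nat) : Prop :=
  exists dR dI, [/\ krull_dim (fun f => f = 0) dR,
                    krull_dim I dI & dR = (dI + c)%N].

End Ideals.

Section UpperLeft.
Variables (T : Type) (n : nat).

Definition ulmx (c : 'I_n * 'I_n) (Z : 'M[T]_n) : 'M[T]_(c.1.+1, c.2.+1) :=
  mxsub (widen_ord (ltn_ord c.1)) (widen_ord (ltn_ord c.2)) Z.

(* The index i - r + a, used to select the r (a < r) rows just before row i,
   or those rows together with row i (a <= r).  The default value i is only
   taken when i - r + a >= n, which is impossible if a <= r <= i; for boxes of
   the diagram the rank r does satisfy r <= i (and r <= j), since w has no 1
   weakly to the left of (i, j) in row i or weakly above it in column j. *)
Definition near_ord (i : 'I_n) (r a : nat) : 'I_n := insubd i (i - r + a)%N.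

Definition block_mx_at (c : 'I_n * 'I_n) (r m : nat) (Z : 'M[T]_n) : 'M[T]_m :=
  \matrix_(a < m, b < m) Z (near_ord c.1 r a) (near_ord c.2 r b).

End UpperLeft.

Section MatrixSchubert.
Variable K : fieldType.

(* perm_mx w has its 1s at the positions (i, w i). *)
Definition rk (n : nat) (w : 'S_n) (c : 'I_n * 'I_n) : nat :=
  \rank (ulmx c (perm_mx w : 'M[K]_n)).

(* The coordinate ring of the n x n matrices is {mpoly K[n * n]}, the variable
   x_(i,j) being numbered by mxvec_index i j. *)
Definition generic_mx (n : nat) : 'M[{mpoly K[n * n]}]_n :=
  \matrix_(i < n, j < n) 'X_(mxvec_index i j).

Definition increasing (m p : nat) (f : 'I_m -> 'I_p) : Prop :=
  forall a b : 'I_m, (a < b)%N -> (f a < f b)%N.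

Definition is_minor (R : comNzRingType) (p q k : nat) (Z : 'M[R]_(p, q)) (f : R)
    : Prop :=
  exists (g : 'I_k -> 'I_p) (h : 'I_k -> 'I_q),
    [/\ increasing g, increasing h & f = \det (mxsub g h Z)].

(* Since K may be finite, the matrix Schubert variety of w is handled as the
   closed subscheme defined by this ideal, not through its K-points. *)
Definition schubert_ideal (n : nat) (w : 'S_n) : {mpoly K[n * n]} -> Prop :=
  ideal_gen (fun f => exists c : 'I_n * 'I_n,
    is_minor (rk w c).+1 (ulmx c (generic_mx n)) f).

Definition complete_intersection (n : nat) (w : 'S_n) : Prop :=
  exists2 c, has_codim (schubert_ideal w) c & generated_by c (schubert_ideal w).

Definition diagram (n : nat) (w : 'S_n) : {set 'I_n * 'I_n} :=
  [set c : 'I_n * 'I_n | (c.2 < w c.1)%N && (c.1 < (w^-1)%g c.2)%N].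

Definition diagram0 (n : nat) (w : 'S_n) : {set 'I_n * 'I_n} :=
  [set c in diagram w | rk w c == 0%N].

Definition diagram_pos (n : nat) (w : 'S_n) : {set 'I_n * 'I_n} :=
  [set c in diagram w | (0 < rk w c)%N].

(* The block w_(p,q): the r x r submatrix immediately north-west of (p, q). *)
Definition nw_block (n : nat) (w : 'S_n) (c : 'I_n * 'I_n) : 'M[K]_(rk w c) :=
  block_mx_at c (rk w c) (rk w c) (perm_mx w).

(* The (r + 1) x (r + 1) block of the generic matrix with south-east corner
   (p, q). *)
Definition generic_block (n : nat) (w : 'S_n) (c : 'I_n * 'I_n) :
    'M[{mpoly K[n * n]}]_((rk w c).+1) :=
  block_mx_at c (rk w c) (rk w c).+1 (generic_mx n).

Definition var_gens (n : nat) (w : 'S_n) : {fset {mpoly K[n * n]}} :=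
  [fset generic_mx n c.1 c.2 | c in diagram0 w]%fset.

Definition det_gens (n : nat) (w : 'S_n) : {fset {mpoly K[n * n]}} :=
  [fset \det (generic_block w c) | c in diagram_pos w]%fset.

End MatrixSchubert.

Arguments schubert_ideal K [n] w _.

(* Main.v *)
From HB Require Import structures.
Require Import Defs.
From mathcomp Require Import all_boot all_order all_fingroup all_algebra.
From mathcomp Require Import finmap mpoly.
From mathcomp Require Import zify.

(** Both sides of the equivalence amount to a condition on the ones of w alone.
    Call w contiguous if, for every box (p, q) of the diagram, the rows above p
    that have their one to the left of column q are consecutive and end at
    p - 1, and likewise for the columns ([contiguous]).  Since r_(p,q)(w) counts
    these ones, this says that the r x r block immediately north-west of (p, q)
    is a permutation matrix v.  Contiguity passes from w to v
    ([contiguous_pattern]), so the theorem follows once contiguous permutations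
    are shown to be exactly those with a complete intersection as matrix
    Schubert variety ([contiguous_ci]).

    The codimension is at most #|D(w)| for every w.  Generically X_w consists of
    the products L * U in which row i of U starts at column w(i), and L is lower
    unitriangular with its free entries at the (k, i) with i < k and
    w(i) < w(k).  The free entries of L and U are indexed by the boxes outside
    D(w).  Setting them to zero one after the other, in a suitable order, and
    taking the kernel of the evaluation at the resulting point each time, gives
    a strict chain of primes above I_w of length n^2 - #|D(w)|
    ([schubert_chain_ge]).

    Conversely, let an ideal contain polynomials with pairwise coprime
    squarefree leading monomials.  The monomials divisible by none of these span
    the quotient, and the supports of such monomials miss one variable for each
    polynomial, so the number of those of degree at most d grows like a power of
    d whose exponent is the number of variables minus the number of polynomials.
    A chain of primes of length e above the ideal produces d^e independent
    elements of degree O(d), hence e is bounded by that exponent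
    ([prime_chain_le]).  With no polynomials at all this bounds the dimension of
    the polynomial ring.  For contiguous w it applies to the determinants of the
    blocks at the boxes of D(w): their antidiagonal terms are leading for the
    weight (2n)^2 - (i + j)^2 of x_(i,j), and contiguity makes the antidiagonals
    pairwise disjoint ([antidiag_disjoint]).  So the codimension is #|D(w)|.

    For contiguous w these determinants generate I_w
    ([block_minors_generate]): by Laplace expansion, the minors attached to a
    box reduce to those of the boxes above it and to its left, except at a box
    of D(w) for the minors through its row and column.  There the entries of the
    rows above the block and of the columns to its left already lie in the
    ideal, which leaves the block determinant only.

    If w is not contiguous, I_w needs more than #|D(w)| generators.  Take a set
    T of matrix positions, at most one in each row and column, that has too many
    elements north-west of some box, but loses this defect on removing any of
    its elements.  The coefficient of the product of the variables at T is then
    a linear form on I_w that vanishes on the product of I_w with the irrelevant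
    ideal.  Each box of D(w) gives such a T, with pairwise distinct pairs of row
    set and column set, so I_w needs at least #|D(w)| generators; a gap in a
    block gives one more T ([few_generators_contiguous]). *)

Set Implicit Arguments.
Unset Strict Implicit.
Unset Printing Implicit Defensive.

Import GRing.Theory.
Local Open Scope ring_scope.

(** * Ideals and generating sets *)

Section IdealGen.
Variable R : comNzRingType.
Implicit Types (S T : R -> Prop) (P : {pred R}) (f g : R).

Lemma ideal_gen_mem S f : S f -> ideal_gen S f.
Proof.
move=> Sf; exists [:: (1, f)]; split; first by move=> t; rewrite inE => /eqP->.
by rewrite big_seq1 mul1r.
Qed.

Lemma ideal_gen0 S : ideal_gen S 0.
Proof. by exists [::]; split => //; rewrite big_nil. Qed.

Lemma ideal_genD S f g : ideal_gen S f -> ideal_gen S g -> ideal_gen S (f + g).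
Proof.
move=> [s [Ss ->]] [t [St ->]]; exists (s ++ t); split; last by rewrite big_cat.
by move=> u; rewrite mem_cat => /orP[/Ss|/St].
Qed.

Lemma ideal_genM S f g : ideal_gen S g -> ideal_gen S (f * g).
Proof.
move=> [s [Ss ->]]; exists [seq (f * t.1, t.2) | t <- s]; split.
  by move=> u /mapP[t /Ss St ->].
by rewrite big_map mulr_sumr; apply: eq_bigr => t _; rewrite mulrA.
Qed.

Lemma ideal_gen_sum S (I : Type) (r : seq I) (Q : pred I) (F : I -> R) :
  (forall i, Q i -> ideal_gen S (F i)) -> ideal_gen S (\sum_(i <- r | Q i) F i).
Proof.
move=> SF; elim/big_rec: _ => [|i f Qi Sf]; first exact: ideal_gen0.
by apply: ideal_genD => //; apply: SF.
Qed.

Lemma ideal_gen_trans S T f :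
  (forall g, S g -> ideal_gen T g) -> ideal_gen S f -> ideal_gen T f.
Proof.
move=> ST [s [Ss ->]]; rewrite big_seq; apply: ideal_gen_sum => t /Ss /ST.
exact: ideal_genM.
Qed.

Lemma ideal_gen_idem S f : ideal_gen (ideal_gen S) f -> ideal_gen S f.
Proof. exact: ideal_gen_trans. Qed.

Lemma idealrD P f g : idealr_closed P -> f \in P -> g \in P -> f + g \in P.
Proof. by move=> [_ _ cP] Pf Pg; rewrite -[f]mul1r cP. Qed.

Lemma idealrM P f g : idealr_closed P -> g \in P -> f * g \in P.
Proof. by move=> [P0 _ cP] Pg; rewrite -[_ * _]addr0 cP. Qed.

Lemma idealr_sum P (I : Type) (r : seq I) (Q : pred I) (F : I -> R) :
  idealr_closed P -> (forall i, Q i -> F i \in P) ->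
  \sum_(i <- r | Q i) F i \in P.
Proof.
move=> cP PF; elim/big_rec: _ => [|i f Qi Pf]; first by case: cP.
by apply: idealrD => //; apply: PF.
Qed.

Lemma ideal_gen_sub_idealr S P f :
  idealr_closed P -> (forall g, S g -> g \in P) -> ideal_gen S f -> f \in P.
Proof.
move=> cP SP [s [Ss ->]]; rewrite big_seq; apply: idealr_sum => // t /Ss /SP.
exact: idealrM.
Qed.

End IdealGen.

(** * Independence modulo an ideal and chains of primes *)

Section Growth.
Variables (K : fieldType) (N : nat).
Local Notation R := {mpoly K[N]}.
Implicit Types (P Q : {pred R}) (s t : seq R).

Definition lincomb (a : nat -> K) s : R := \sum_(i < size s) a i *: s`_i.

Definition indep_mod P s :=
  forall a, lincomb a s \in P -> forall i, (i < size s)%N -> a i = 0.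

Lemma idealrZ P (a : K) f : idealr_closed P -> f \in P -> a *: f \in P.
Proof. by move=> cP Pf; rewrite -mul_mpolyC; apply: idealrM. Qed.

Lemma lincomb_cat a s t :
  lincomb a (s ++ t) = lincomb a s + lincomb (fun i => a (size s + i)%N) t.
Proof.
rewrite /lincomb size_cat big_split_ord /=; congr (_ + _); apply: eq_bigr => i _.
  by rewrite nth_cat ltn_ord.
by rewrite nth_cat ltnNge leq_addr /= addKn.
Qed.

Lemma lincomb_map_mul a f s : lincomb a [seq f * x | x <- s] = f * lincomb a s.
Proof.
rewrite /lincomb size_map mulr_sumr; apply: eq_bigr => i _.
by rewrite (nth_map 0) ?ltn_ord // scalerAr.
Qed.

(** A dependence modulo P of the joint family is one modulo Q, where the
    multiples of f vanish; this kills the coefficients of s.  What is left is f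
    times a combination of t, and P is prime with f outside of it. *)
Lemma indep_mod_cat P Q f s t :
    prime_ideal P -> idealr_closed Q -> {subset P <= Q} ->
    f \in Q -> f \notin P -> indep_mod Q s -> indep_mod P t ->
  indep_mod P (s ++ [seq f * x | x <- t]).
Proof.
move=> [cP pP] cQ PQ Qf nPf Qs Pt a; rewrite lincomb_cat lincomb_map_mul => Pa.
have a0 i : (i < size s)%N -> a i = 0.
  apply: Qs; rewrite -[lincomb a s](addrK (f * lincomb (fun i => a (size s + i)%N) t)).
  rewrite addrC -mulN1r; case: (cQ) => _ _; apply; last exact: PQ.
  by rewrite mulrC; apply: idealrM.
have s0 : lincomb a s = 0.
  by rewrite /lincomb big1 // => i _; rewrite a0 ?scale0r ?ltn_ord.
move: Pa; rewrite s0 add0r => /pP; rewrite (negbTE nPf) => /= Pa.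
move=> i; rewrite size_cat size_map; case: (ltnP i (size s)) => [/a0-> //|sle].
by move=> ilt; rewrite -(subnKC sle) (Pt _ Pa) // ltn_subLR.
Qed.

Lemma msizeM_leD (f g : R) (a b : nat) :
  (msize f <= a.+1)%N -> (msize g <= b.+1)%N -> (msize (f * g) <= (a + b).+1)%N.
Proof.
move=> fa gb; have [->|f0] := eqVneq f 0; first by rewrite mul0r msize0.
have [->|g0] := eqVneq g 0; first by rewrite mulr0 msize0.
rewrite msizeM //; move: (msize f) (msize g) fa gb => u v fa gb.
by rewrite -subn1; lia.
Qed.

Lemma indep_mod_powers P Q f s D k d :
    prime_ideal P -> idealr_closed Q -> {subset P <= Q} ->
    f \in Q -> f \notin P -> indep_mod Q s ->
    all (fun x : R => msize x <= D.+1)%N s -> (msize f <= k.+1)%N ->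
  exists t, [/\ indep_mod P t, size t = (d * size s)%N &
                all (fun x : R => msize x <= (D + d * k).+1)%N t].
Proof.
move=> pP cQ PQ Qf nPf Qs sD fk; elim: d => [|d [t [Pt szt tD]]].
  by exists [::]; split.
exists (s ++ [seq f * x | x <- t]); split; first exact: indep_mod_cat Qs Pt.
  by rewrite size_cat size_map szt mulSn.
rewrite all_cat; apply/andP; split.
  by apply: sub_all sD => x /leq_trans; apply; rewrite ltnS leq_addr.
rewrite all_map; apply: sub_all tD => x xD /=.
by rewrite mulSn addnCA; apply: msizeM_leD.
Qed.

(** Each step from P_i up to P_(i+1) multiplies the size of the independent
    family by d, at the cost of d times the degree of an element of
    P_(i+1) outside P_i; the number k bounds all these degrees, and the
    starting point is the family [:: 1] modulo the top prime. *)
Lemma indep_mod_chain e (P : nat -> {pred R}) :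
    (forall k, (k <= e)%N -> prime_ideal (P k)) ->
    (forall k, (k < e)%N ->
       {subset P k <= P k.+1} /\ exists2 f, f \in P k.+1 & f \notin P k) ->
  exists k, forall d, exists s, [/\ indep_mod (P 0%N) s, size s = (d ^ e)%N &
    all (fun x : R => msize x <= (e * (d * k)).+1)%N s].
Proof.
elim: e P => [|e IHe] P pP sP.
  exists 0%N => d; exists [:: 1]; split=> //=; last by rewrite msize1.
  move=> a; rewrite /lincomb big_ord1 /= => Pa [] // _.
  have [[_ nP1 cP] _] := pP 0%N isT; apply: contraNeq nP1 => a0.
  by rewrite -[1](scalerK a0) idealrZ; case: (pP 0%N isT).
have [j lej|j ltj|k IHk] := IHe (fun j => P j.+1).
- exact: (pP j.+1).
- exact: (sP j.+1).
have [PQ [f Qf nPf]] := sP 0%N isT; have pP0 := pP 0%N isT; have [cQ _] := pP 1%N isT.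
(* the size of f is used as a bound for its degree *)
exists (maxn k (msize f)) => d; have [s [Qs szs sD]] := IHk d.
have [|t [Pt szt tD]] := indep_mod_powers d pP0 cQ PQ Qf nPf Qs sD (k := msize f).
  exact: leqnSn.
exists t; split=> //; first by rewrite szt szs expnS.
apply: sub_all tD => x /leq_trans; apply; rewrite ltnS mulSn addnC.
by rewrite leq_add // ?leq_mul // ?leq_maxr ?leq_maxl.
Qed.

End Growth.

(** * Standard monomials and the upper bound on chains of primes *)

Section SquareFree.
Variable N : nat.
Implicit Types (A B : {set 'I_N}) (m : 'X_{1..N}).

Definition sqfree A : 'X_{1..N} := [multinom (x \in A : nat) | x < N].

Lemma sqfreeE A x : sqfree A x = (x \in A). Proof. exact: mnmE. Qed.

Lemma sqfree_inj : injective sqfree.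
Proof.
move=> A B eqAB; apply/setP=> x; have := sqfreeE A x.
by rewrite eqAB sqfreeE; do 2!case: (x \in _).
Qed.

Lemma sqfree_leP A m : reflect (forall x, x \in A -> m x != 0%N) (sqfree A <= m)%MM.
Proof.
apply: (iffP mnm_lepP) => [le x Ax|le x].
  by have := le x; rewrite sqfreeE Ax; case: (m x).
by rewrite sqfreeE; case: (boolP (x \in A)) => // /le; case: (m x).
Qed.

Lemma sqfree_imset (I : finType) (F : I -> 'I_N) : injective F ->
  sqfree [set F i | i in I] = (\sum_i U_(F i))%MM.
Proof.
move=> Finj; apply/mnmP=> x; rewrite sqfreeE mnm_sumE.
have [/imsetP[i _ ->]|nx] := boolP (x \in _).
  rewrite (bigD1 i) //= mnm1E eqxx big1 ?addn0 // => j ne_ji.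
  by rewrite mnm1E inj_eq // (negbTE ne_ji).
rewrite big1 // => i _; rewrite mnm1E; case: eqP => // Fi.
by rewrite -Fi imset_f in nx.
Qed.

Lemma mdeg_sqfree A : mdeg (sqfree A) = #|A|.
Proof.
rewrite mdegE -sum1_card [RHS]big_mkcond; apply: eq_bigr => x _.
by rewrite sqfreeE; case: (x \in A).
Qed.

End SquareFree.

Section StandardMonomials.
Variables (K : fieldType) (N : nat) (C : finType).
Local Notation R := {mpoly K[N]}.
Variables (P : {pred R}) (B : C -> {set 'I_N}) (g : C -> R) (wt : 'I_N -> nat).

Definition weight (m : 'X_{1..N}) : nat := \sum_x m x * wt x.

Lemma weightD m1 m2 : weight (m1 + m2)%MM = (weight m1 + weight m2)%N.
Proof. by rewrite -big_split; apply: eq_bigr => x _; rewrite mnmDE mulnDl. Qed.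

Hypothesis cP : idealr_closed P.
Hypothesis gP : forall c, g c \in P.
Hypothesis B_disjoint : forall c c', c != c' -> [disjoint B c & B c'].
Hypothesis g_lead : forall c, (g c)@_(sqfree (B c)) != 0.
Hypothesis g_lower : forall c m, m \in msupp (g c) -> m != sqfree (B c) ->
  (mdeg m <= #|B c|)%N /\ (weight m < weight (sqfree (B c)))%N.

Local Notation k := (N - #|C|)%N.

(** A code lists at most k variables together with exponents up to D.  It
    covers every standard monomial of degree at most D, with repetitions, so
    that an upper bound for their number needs no exact count. *)
Definition monomial_code (D : nat) := ({ffun 'I_k -> 'I_N} * {ffun 'I_k -> 'I_D.+1})%type.

Definition decode D (t : monomial_code D) : 'X_{1..N} :=
  (\sum_i U_(t.1 i) *+ t.2 i)%MM.

(** A monomial that no sqfree (B c) divides misses a variable of each B c, and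
    these variables are distinct since the sets B c are disjoint. *)
Lemma card_nonzero m : (forall c, ~~ (sqfree (B c) <= m)%MM) ->
  (#|[set x | m x != 0%N]| <= k)%N.
Proof.
move=> m_std; have zero c : exists x, (x \in B c) && (m x == 0%N).
  apply/existsP; apply: contraR (m_std c) => /existsPn nz.
  by apply/sqfree_leP => x Bx; have := nz x; rewrite Bx.
have /fin_all_exists[z zP] := zero.
have z_inj : injective z.
  move=> c c' eqz; apply/eqP/negPn/negP => /B_disjoint /disjoint_setI0 /setP/(_ (z c)).
  by rewrite !inE {2}eqz; case/andP: (zP c) => -> _; case/andP: (zP c') => ->.
have -> : [set x | m x != 0%N] = ~: [set x | m x == 0%N].
  by apply/setP => x; rewrite !inE.
rewrite cardsCs setCK card_ord leq_sub2l // -(card_imset predT z_inj) subset_leq_card //.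
by apply/subsetP => _ /imsetP[c _ ->]; rewrite inE; case/andP: (zP c).
Qed.

Lemma standard_decode D m : (forall c, ~~ (sqfree (B c) <= m)%MM) ->
  (mdeg m <= D)%N -> exists t : monomial_code D, decode t = m.
Proof.
move=> /card_nonzero; set S := [set x | _] => leSk mD.
have leD x : (m x <= D)%N by rewrite (leq_trans _ mD) // mdegE (bigD1 x) //= leq_addr.
pose x0 (i : 'I_k) : 'I_N := widen_ord (leq_subr _ _) i.
pose sigma (i : 'I_k) := nth (x0 i) (enum S) i.
pose e (i : 'I_k) : 'I_D.+1 := inord (if (i < #|S|)%N then m (sigma i) else 0).
exists ([ffun i => sigma i], [ffun i => e i]); apply/mnmP => y.
rewrite /decode mnm_sumE /=.
have -> : (\sum_(i < k) (U_([ffun i => sigma i] i) *+ [ffun i => e i] i)%MM y)%N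
   = (\sum_(i < k | (i < #|S|)%N) ((sigma i == y) * m (sigma i)))%N.
  rewrite [RHS]big_mkcond; apply: eq_bigr => i _; rewrite mulmnE mnm1E !ffunE /e.
  by case: ifP => _; rewrite inordK ?muln0 // ltnS.
have [Sy|nSy] := boolP (y \in S); last first.
  rewrite big1 => [|i ltiS]; last first.
    case: eqP => // eq_y; rewrite -eq_y /sigma -mem_enum mem_nth ?cardE // in nSy.
    by rewrite -cardE.
  by move: nSy; rewrite inE negbK => /eqP.
have lt_y : (index y (enum S) < #|S|)%N by rewrite cardE index_mem mem_enum.
pose iy := Ordinal (leq_trans lt_y leSk).
have sy : sigma iy = y by rewrite /sigma nth_index ?mem_enum.
rewrite (bigD1 iy) //= sy eqxx mul1n big1 ?addn0 // => i /andP[ltiS ne_i].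
case: eqP => // si; case/eqP: ne_i; apply: val_inj; rewrite /= -si /sigma.
by rewrite index_uniq ?enum_uniq // -cardE.
Qed.

(** The codes cover more than the standard monomials, which only enlarges this
    span and does not affect the dimension count. *)
Definition std_span D (f : R) :=
  exists a : monomial_code D -> K, f - \sum_t a t *: 'X_[decode t] \in P.

Lemma std_span0 D : std_span D 0.
Proof.
exists (fun=> 0); rewrite big1 ?subr0; first by case: cP.
by move=> t _; rewrite scale0r.
Qed.

Lemma std_spanD D f h c : std_span D f -> std_span D h -> std_span D (c *: f + h).
Proof.
move=> [a Pa] [b Pb]; exists (fun t => c * a t + b t).
rewrite (_ : _ - _ = c *: (f - \sum_t a t *: 'X_[decode t]) +
    (h - \sum_t b t *: 'X_[decode t])); first by rewrite idealrD ?idealrZ.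
rewrite scalerBr addrACA -opprD; congr (_ - _).
rewrite scaler_sumr -big_split; apply: eq_bigr => t _ /=.
by rewrite scalerA scalerDl.
Qed.

Lemma std_span_ideal D f h : f - h \in P -> std_span D h -> std_span D f.
Proof.
move=> Pfh [a Pa]; exists a; rewrite -[f](subrK h) -addrA; exact: idealrD.
Qed.

Lemma std_span_sum D (I : eqType) (r : seq I) (a : I -> K) (F : I -> R) :
  (forall i, i \in r -> std_span D (F i)) -> std_span D (\sum_(i <- r) a i *: F i).
Proof.
move=> SF; rewrite big_seq; elim/big_rec: _ => [|i f ri Sf]; first exact: std_span0.
exact: std_spanD (SF i ri) Sf.
Qed.

(** Division by the polynomials g: if sqfree (B c) divides m, subtracting the
    multiple of g c with leading monomial m leaves terms of smaller weight and
    of no greater degree. *)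
Lemma std_spanX D m : (mdeg m <= D)%N -> std_span D 'X_[m].
Proof.
have [n] := ubnP (weight m); elim: n m => // n IHn m; rewrite ltnS => le_n mD.
have [[c lecm]|m_std] := altP (@existsP _ (fun c => sqfree (B c) <= m)%MM); last first.
  have [c|t <-] := @standard_decode D m _ mD; first by move/existsPn: m_std; apply.
  exists (fun t' => (t' == t)%:R); rewrite (bigD1 t) //= eqxx scale1r big1 ?addr0 ?subrr.
    by case: cP.
  by move=> t' /negbTE->; rewrite scale0r.
set m' := (m - sqfree (B c))%MM; have mE : (m' + sqfree (B c))%MM = m by rewrite submK.
set l := (g c)@_(sqfree (B c)).
pose h := \sum_(u <- rem (sqfree (B c)) (msupp (g c)))
            (- (l^-1 * (g c)@_u)) *: 'X_[u + m'] : R.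
apply: (@std_span_ideal _ _ h).
  suff -> : 'X_[m] - h = (l^-1 *: 'X_[m']) * g c by apply: idealrM.
  rewrite [in RHS](mpolyE (g c)) (big_rem (sqfree (B c))) /=; last first.
    by rewrite mcoeff_msupp.
  rewrite -/l mulrDr -scalerAl -scalerAr [l^-1 *: _]scalerA mulVf ?g_lead //.
  rewrite scale1r -mpolyXD mE; congr (_ + _).
  rewrite -sumrN mulr_sumr; apply: eq_bigr => u _.
  by rewrite scaleNr opprK -scalerAl -scalerAr scalerA -mpolyXD addmC.
apply: std_span_sum => u; rewrite mem_rem_uniq ?msupp_uniq // inE => /andP[ne_u gu].
have [leu ltu] := g_lower gu ne_u; apply: IHn.
  by apply: leq_trans le_n; rewrite -mE !weightD addnC ltn_add2l.
by apply: leq_trans mD; rewrite -mE !mdegD mdeg_sqfree addnC leq_add2l.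
Qed.

Lemma std_span_msize D f : (msize f <= D.+1)%N -> std_span D f.
Proof.
move=> fD; rewrite (mpolyE f); apply: std_span_sum => m /msize_mdeg_lt lt_m.
by apply: std_spanX; rewrite -ltnS (leq_trans lt_m).
Qed.

Lemma card_monomial_code D : #|{: monomial_code D}| = ((N * D.+1) ^ k)%N.
Proof. by rewrite card_prod !card_ffun !card_ord expnMn. Qed.

(** The coordinates of the family over the coded monomials form a matrix whose
    rows are independent: a relation between them would put a nontrivial
    combination of the family into P. *)
Lemma indep_mod_size D s : indep_mod P s ->
  all (fun f : R => msize f <= D.+1)%N s -> (size s <= (N * D.+1) ^ k)%N.
Proof.
move=> sP sD; rewrite -(card_monomial_code D) leqNgt; apply/negP => lt_s.
have /fin_all_exists[a Pa] (i : 'I_(size s)) :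
    exists a : monomial_code D -> K, s`_i - \sum_t a t *: 'X_[decode t] \in P.
  by apply: std_span_msize; apply: (allP sD); rewrite mem_nth.
pose M := \matrix_(i < size s, t < #|{: monomial_code D}|) a i (enum_val t).
(* M has more rows than columns *)
have kM : kermx M != 0.
  rewrite -mxrank_eq0 mxrank_ker subn_eq0 -ltnNge.
  exact: leq_ltn_trans (rank_leq_col M) lt_s.
pose v := nz_row (kermx M); have vM : v *m M = 0 by apply/sub_kermxP/nz_row_sub.
have v0 : v != 0 by rewrite nz_row_eq0.
have [i vi] : exists i, v 0 i != 0 by apply/rV0Pn.
pose b j := if insub j is Some i then v 0 i else 0.
have bE (j : 'I_(size s)) : b j = v 0 j by rewrite /b valK.
case/eqP: vi; rewrite -bE; apply: sP (ltn_ord i); rewrite /lincomb.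
rewrite (eq_bigr (fun j : 'I_(size s) => b j *: (s`_j - \sum_t a j t *: 'X_[decode t]) +
    b j *: \sum_t a j t *: 'X_[decode t])); last by move=> j _; rewrite -scalerDr subrK.
rewrite big_split /= idealrD //; first by apply: idealr_sum => // j _; apply: idealrZ.
rewrite (eq_bigr (fun j : 'I_(size s) => \sum_t (b j * a j t) *: 'X_[decode t])); last first.
  by move=> j _; rewrite scaler_sumr; apply: eq_bigr => t _; rewrite scalerA.
rewrite exchange_big big1 /=; first by case: cP.
move=> t _; rewrite -scaler_suml; have /rowP/(_ (enum_rank t)) := vM.
rewrite !mxE => e0; rewrite [X in X *: _](_ : _ = 0) ?scale0r // -[RHS]e0.
by apply: eq_bigr => j _; rewrite !mxE enum_rankK bE.
Qed.

End StandardMonomials.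

(** A chain of length e gives d^e elements of degree at most e * d * q that are
    independent modulo the bottom prime, while the standard monomials up to this
    degree number at most a constant b times d^k.  With e > k this fails at
    d = b + 1. *)
Lemma prime_chain_le (K : fieldType) (N : nat) (C : finType)
    (I : {mpoly K[N]} -> Prop) (B : C -> {set 'I_N}) (g : C -> {mpoly K[N]})
    (wt : 'I_N -> nat) (e : nat) :
    (forall c, I (g c)) ->
    (forall c c', c != c' -> [disjoint B c & B c']) ->
    (forall c, (g c)@_(sqfree (B c)) != 0) ->
    (forall c m, m \in msupp (g c) -> m != sqfree (B c) ->
       (mdeg m <= #|B c|)%N /\ (weight wt m < weight wt (sqfree (B c)))%N) ->
  prime_chain I e -> (e <= N - #|C|)%N.
Proof.
move=> gI Bd gl gw [P [pP sP]]; set k := (N - #|C|)%N.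
have [j /pP[]//|//|q chain] := @indep_mod_chain K N e P.
have [cP0 P0I] : idealr_closed (P 0%N) /\ forall f, I f -> f \in P 0%N.
  by have [[]] := pP 0%N isT.
rewrite leqNgt; apply/negP => lt_ke.
pose b := ((N * (e * q).+1) ^ k)%N; have [s [Ps szs sD]] := chain b.+1.
have := indep_mod_size cP0 (fun c => P0I _ (gI c)) Bd gl gw Ps sD.
rewrite szs leqNgt => /negP; apply.
have le1 : (N * (e * (b.+1 * q)).+1 <= N * (e * q).+1 * b.+1)%N.
  rewrite -mulnA leq_mul2l; apply/orP; right; nia.
apply: (@leq_ltn_trans ((N * (e * q).+1 * b.+1) ^ k)).
  by rewrite -/k; case: (posnP k) => [->|k0]; rewrite ?expn0 ?leq_exp2r.
rewrite expnMn -/b; apply: (@leq_trans (b.+1 ^ k.+1)); last by rewrite leq_pexp2l.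
have [-> //|b0] := posnP b; by rewrite expnS ltn_pmul2r // expn_gt0.
Qed.

(** * Rank counts and minors of the generic matrix *)

Section Increasing.

Lemma increasing_inj k n (g : 'I_k -> 'I_n) : increasing g -> injective g.
Proof.
move=> g_inc a b eq_g; apply: val_inj.
by case: (ltngtP a b) => // /g_inc; rewrite eq_g ltnn.
Qed.

Lemma increasing_enum n k (A : {set 'I_n}) : #|A| = k ->
  exists g : 'I_k -> 'I_n, increasing g /\ [set g a | a in 'I_k] = A.
Proof.
move=> cardA; have [A0|[x0 Ax0]] := set_0Vmem A; last first.
  have szA : size (enum A) = k by rewrite -cardE.
  have sortA : sorted (fun x y : 'I_n => (x < y)%N) (enum A).
    rewrite {1}/enum_mem sorted_filter //; first by move=> ? ? ?; apply: ltn_trans.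
    by have := iota_ltn_sorted 0 n; rewrite -val_enum_ord sorted_map -enumT.
  exists (fun a : 'I_k => nth x0 (enum A) a); split.
    move=> a b lt_ab; apply: (sorted_ltn_nth _ x0 sortA) => //.
    - by move=> ? ? ?; apply: ltn_trans.
    - by rewrite inE szA.
    - by rewrite inE szA.
  apply/setP => x; apply/imsetP/idP => [[a _ ->]|Ax].
    by rewrite -mem_enum mem_nth // szA.
  have lt_x : (index x (enum A) < k)%N by rewrite -szA index_mem mem_enum.
  by exists (Ordinal lt_x) => //=; rewrite nth_index // mem_enum.
move: cardA; rewrite A0 cards0 => <-.
have g0 : 'I_0 -> 'I_n by case.
exists g0; split; first by case.
by apply/setP=> x; rewrite inE; apply/imsetP => -[[]].
Qed.

End Increasing.

Section RankCount.
Variables (n : nat) (w : 'S_n).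

Definition nw_count (p q : nat) : nat := #|[set i : 'I_n | (i < p)%N && (w i < q)%N]|.

(** Restricted to the rows counted on the right, the submatrix of the
    permutation matrix has independent rows, and its other rows are zero. *)
Lemma rkE (K : fieldType) (c : 'I_n * 'I_n) : rk K w c = nw_count c.1.+1 c.2.+1.
Proof.
rewrite /rk; set M := ulmx _ _.
have ME a b : M a b = (w (widen_ord (ltn_ord c.1) a) == widen_ord (ltn_ord c.2) b)%:R.
  by rewrite !mxE.
rewrite /nw_count; set A := [set i | _].
have ltA (x : 'I_#|A|) : (enum_val x < c.1.+1)%N /\ (w (enum_val x) < c.2.+1)%N.
  by have := enum_valP x; rewrite inE => /andP.
pose f x : 'I_c.1.+1 := Ordinal (ltA x).1.
pose h x : 'I_c.2.+1 := Ordinal (ltA x).2.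
have fE x : widen_ord (ltn_ord c.1) (f x) = enum_val x by apply: val_inj.
have hE x : widen_ord (ltn_ord c.2) (h x) = w (enum_val x) by apply: val_inj.
(* rows of M without a one are zero *)
have full : (M <= rowsub f M)%MS.
  apply/row_subP => a; have [Aa|nAa] := boolP (widen_ord (ltn_ord c.1) a \in A).
    rewrite (_ : row a M = row (enum_rank_in Aa (widen_ord (ltn_ord c.1) a)) (rowsub f M)).
      exact: row_sub.
    apply/rowP => b; rewrite !mxE /=.
    by rewrite fE enum_rankK_in.
  rewrite (_ : row a M = 0) ?sub0mx //; apply/rowP => b; rewrite mxE ME mxE.
  case: eqP => // wab; case/negP: nAa; rewrite inE wab /= ltn_ord; exact: ltn_ord.
apply/eqP; rewrite eqn_leq; apply/andP; split.
  by apply: leq_trans (mxrankS full) _; apply: rank_leq_row.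
have := mxrank1 K #|A|; rewrite (_ : 1%:M = rowsub f M *m colsub h 1%:M).
  by move=> <-; apply: leq_trans (mxrankM_maxl _ _) (mxrankS (rowsub_sub _ _)).
rewrite -mxsub_mul mulmx1; apply/matrixP => x y; rewrite !mxE /= fE hE.
by rewrite (inj_eq (@perm_inj _ w)) (inj_eq enum_val_inj).
Qed.

End RankCount.

Section Minors.
Variables (K : fieldType) (n : nat).
Local Notation R := {mpoly K[n * n]}.
Local Notation box := ('I_n * 'I_n)%type.
Local Notation X := (generic_mx K n).

Definition box_var (c : box) : 'I_(n * n) := mxvec_index c.1 c.2.

Lemma box_var_inj : injective box_var.
Proof.
have [f fK _] := curry_mxvec_bij n n; apply: (can_inj (g := f)) => -[i j].
by rewrite -[RHS]fK.
Qed.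

Lemma generic_mxE (i j : 'I_n) : X i j = 'X_(box_var (i, j)).
Proof. by rewrite mxE. Qed.

Definition box_mon (T : {set box}) : 'X_{1..n * n} := sqfree (box_var @: T).

Lemma box_mon_inj : injective box_mon.
Proof. by move=> T T' /sqfree_inj; apply: imset_inj; exact: box_var_inj. Qed.

Definition perm_boxes k (g h : 'I_k -> 'I_n) (s : 'S_k) : {set box} :=
  [set (g a, h (s a)) | a in 'I_k].

Lemma perm_boxes_inj k (g h : 'I_k -> 'I_n) :
  injective g -> injective h -> injective (perm_boxes g h).
Proof.
move=> gI hI s s' /setP eqT; apply/permP => a.
have := eqT (g a, h (s a)); rewrite /perm_boxes imset_f // => /esym /imsetP[b _ [/gI->]].
by move/hI.
Qed.

(** The Leibniz expansion as a signed sum of squarefree monomials, from which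
    the coefficients of a minor can be read off. *)
Lemma det_genericE k (g h : 'I_k -> 'I_n) : injective g ->
  \det (mxsub g h X) =
    \sum_(s : 'S_k) ((-1) ^+ s : K) *: 'X_[box_mon (perm_boxes g h s)].
Proof.
move=> gI; apply: eq_bigr => s _; rewrite -mul_mpolyC rmorph_sign; congr (_ * _).
rewrite (eq_bigr (fun a => 'X_[U_(box_var (g a, h (s a)))])); last first.
  by move=> a _; rewrite mxE generic_mxE.
rewrite mprodXE; congr 'X_[_]; rewrite /box_mon /perm_boxes -imset_comp sqfree_imset //.
by move=> a b /box_var_inj[/gI].
Qed.

Lemma mcoeff_minor_neq0 k (g h : 'I_k -> 'I_n) m : injective g ->
  (\det (mxsub g h X))@_m != 0 -> exists s, m = box_mon (perm_boxes g h s).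
Proof.
move=> gI; rewrite det_genericE // raddf_sum /= => nz.
have [s /eqP <-|none] := pickP (fun s => box_mon (perm_boxes g h s) == m); first by exists s.
case/eqP: nz; apply: big1 => s _; rewrite mcoeffZ mcoeffX.
by have := none s => /= ->; rewrite mulr0.
Qed.

Lemma mcoeff_minor k (g h : 'I_k -> 'I_n) s : injective g -> injective h ->
  (\det (mxsub g h X))@_(box_mon (perm_boxes g h s)) = (-1) ^+ s.
Proof.
move=> gI hI; rewrite det_genericE // raddf_sum /= (bigD1 s) //= big1 ?addr0.
  by rewrite mcoeffZ mcoeffX eqxx mulr1.
move=> s' ne_s; rewrite mcoeffZ mcoeffX (inj_eq box_mon_inj).
by rewrite (inj_eq (perm_boxes_inj gI hI)) (negbTE ne_s) mulr0.
Qed.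

End Minors.

Section SchubertIdeal.
Variables (K : fieldType) (n : nat) (w : 'S_n).
Local Notation R := {mpoly K[n * n]}.
Local Notation box := ('I_n * 'I_n)%type.
Local Notation X := (generic_mx K n).

Definition schubert_minor (f : R) : Prop :=
  exists (c : box) (g h : 'I_(nw_count w c.1.+1 c.2.+1).+1 -> 'I_n),
    [/\ increasing g, increasing h, forall a, (g a < c.1.+1)%N,
        forall a, (h a < c.2.+1)%N & f = \det (mxsub g h X)].

(** The generators in terms of minors of the full generic matrix, with the rank
    replaced by a count of ones. *)
Lemma schubert_idealE f : schubert_ideal K w f <-> ideal_gen schubert_minor f.
Proof.
split; apply: ideal_gen_trans => {}f [c].
  rewrite rkE => -[g [h [g_inc h_inc ->]]]; apply: ideal_gen_mem.
  exists c, (widen_ord (ltn_ord c.1) \o g), (widen_ord (ltn_ord c.2) \o h).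
  split; try by move=> a /=; apply: ltn_ord.
  - by move=> a b /g_inc.
  - by move=> a b /h_inc.
  - by congr (\det _); apply/matrixP => a b; rewrite !mxE.
move=> [g [h [g_inc h_inc g_le h_le ->]]]; apply: ideal_gen_mem.
exists c; rewrite rkE; exists (fun a => inord (g a)), (fun a => inord (h a)); split.
- by move=> a b /g_inc; rewrite !inordK.
- by move=> a b /h_inc; rewrite !inordK.
- congr (\det _); apply/matrixP => a b; rewrite !mxE; congr 'X_(mxvec_index _ _).
    by apply: val_inj; rewrite /= inordK.
  by apply: val_inj; rewrite /= inordK.
Qed.

End SchubertIdeal.

(** * The diagram and contiguous permutations *)

Lemma card_ord_itv n (a b : nat) : (b <= n)%N ->
  #|[set x : 'I_n | (a <= x < b)%N]| = (b - a)%N.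
Proof.
move=> le_bn; rewrite cardE -(size_map val) -(size_iota a (b - a)).
apply/perm_size/uniq_perm; rewrite ?(map_inj_uniq val_inj) ?enum_uniq ?iota_uniq //.
move=> x; rewrite mem_iota; apply/mapP/idP => [[y]|].
  by rewrite mem_enum inE => y_ab -> /=; lia.
move=> x_ab; have lt_xn : (x < n)%N by lia.
by exists (Ordinal lt_xn) => //; rewrite mem_enum inE /=; lia.
Qed.

Lemma upper_closed_itv n (S : {set 'I_n}) (p : nat) : (p <= n)%N ->
    (forall x, x \in S -> (x < p)%N) ->
    (forall x y : 'I_n, x \in S -> (x < y)%N -> (y < p)%N -> y \in S) ->
  (#|S| <= p)%N /\ forall x : 'I_n, (x \in S) = (p - #|S| <= x < p)%N.
Proof.
move=> le_pn S_lt S_up.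
have cardS a : (forall x, x \in S -> (a <= x)%N) -> (#|S| <= p - a)%N.
  move=> S_ge; rewrite -(@card_ord_itv n) //; apply: subset_leq_card.
  by apply/subsetP => x Sx; rewrite inE S_ge // S_lt.
split=> [|x]; first by have := cardS 0%N; rewrite subn0; apply.
apply/idP/idP => [Sx|/andP[le_x lt_x]].
  rewrite S_lt // andbT leq_subLR addnC -leq_subLR -(@card_ord_itv n) //.
  apply: subset_leq_card; apply/subsetP => y; rewrite inE => /andP[].
  by rewrite leq_eqVlt => /orP[/eqP/val_inj <-|/(S_up _ _ Sx)/[apply]].
apply: contraLR le_x => nSx; rewrite -ltnNge.
suff: (#|S| <= p - x.+1)%N by lia.
apply: cardS => y Sy; rewrite ltnNge leq_eqVlt; apply/negP => /orP[/eqP/val_inj eq_yx|lt_yx].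
  by rewrite -eq_yx Sy in nSx.
by rewrite (S_up y x) in nSx.
Qed.

Section Diagram.
Variables (n : nat) (w : 'S_n).
Implicit Types c : 'I_n * 'I_n.

Definition diag_rank c := nw_count w c.1.+1 c.2.+1.

(** The ones strictly north-west of a diagram box c fill consecutive rows and
    columns ending next to c.  This is phrased as upward closure, since this
    form mentions no rank and is inherited by sub-blocks at once. *)
Definition contiguous : Prop := forall c, c \in diagram w ->
  (forall a i : 'I_n, (a < i)%N -> (i < c.1)%N -> (w a < c.2)%N -> (w i < c.2)%N) /\
  (forall b j : 'I_n, (b < j)%N -> (j < c.2)%N ->
     ((w^-1)%g b < c.1)%N -> ((w^-1)%g j < c.1)%N).

Lemma diagramP c : c \in diagram w -> (c.2 < w c.1)%N /\ (c.1 < (w^-1)%g c.2)%N.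
Proof. by rewrite inE => /andP. Qed.

(** Row c.1 and column c.2 have no one weakly north-west of c. *)
Lemma diagram_nw c (i : 'I_n) : c \in diagram w ->
  ((i < c.1.+1) && (w i < c.2.+1))%N = ((i < c.1) && (w i < c.2))%N.
Proof.
move=> /diagramP[ltw ltv]; have [->|ne_i] := eqVneq i c.1; first by lia.
have [wi|ne_wi] := eqVneq (w i) c.2; first by rewrite -wi permK in ltv; lia.
by move: ne_i ne_wi; rewrite -!val_eqE /=; lia.
Qed.

Lemma diag_rankE c : c \in diagram w -> diag_rank c = nw_count w c.1 c.2.
Proof. by move=> Dc; congr #|pred_of_set _|; apply/setP=> i; rewrite !inE diagram_nw. Qed.

Lemma nw_countV p q : nw_count w p q = #|[set j : 'I_n | (j < q)%N && ((w^-1)%g j < p)%N]|.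
Proof.
rewrite /nw_count -(card_imset _ (@perm_inj _ w)); congr #|pred_of_set _|.
apply/setP=> j; rewrite inE; apply/imsetP/idP => [[i]|].
  by rewrite inE => /andP[lt_i lt_wi] ->; rewrite permK lt_wi.
by move=> /andP[lt_j lt_vj]; exists ((w^-1)%g j); rewrite ?inE permKV ?lt_j ?lt_vj.
Qed.

Section Contiguous.
Hypothesis w_cont : contiguous.
Variable c : 'I_n * 'I_n.
Hypothesis Dc : c \in diagram w.

Lemma contiguous_rows : (diag_rank c <= c.1)%N /\
  forall i : 'I_n, ((i < c.1) && (w i < c.2))%N = (c.1 - diag_rank c <= i < c.1)%N.
Proof.
have [up _] := w_cont Dc; rewrite diag_rankE //.
have [| | |le E] := @upper_closed_itv n [set i : 'I_n | (i < c.1)%N && (w i < c.2)%N] c.1.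
- exact: ltnW.
- by move=> x; rewrite inE => /andP[].
- by move=> x y; rewrite !inE => /andP[_ wx] lt_xy lt_y; rewrite lt_y (up x y).
by split=> // i; rewrite -E inE.
Qed.

Lemma contiguous_cols : (diag_rank c <= c.2)%N /\
  forall j : 'I_n, ((j < c.2) && ((w^-1)%g j < c.1))%N = (c.2 - diag_rank c <= j < c.2)%N.
Proof.
have [_ up] := w_cont Dc; rewrite diag_rankE // nw_countV.
have [| | |le E] :=
  @upper_closed_itv n [set j : 'I_n | (j < c.2)%N && ((w^-1)%g j < c.1)%N] c.2.
- exact: ltnW.
- by move=> x; rewrite inE => /andP[].
- by move=> x y; rewrite !inE => /andP[_ wx] lt_xy lt_y; rewrite lt_y (up x y).
by split=> // j; rewrite -E inE.
Qed.

End Contiguous.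

Lemma diag_rank_le c : c \in diagram w -> (diag_rank c <= c.1)%N /\ (diag_rank c <= c.2)%N.
Proof.
move=> Dc; rewrite diag_rankE //; split.
  rewrite -[leqRHS]subn0 -(@card_ord_itv n) ?(ltnW (ltn_ord _)) //.
  by apply: subset_leq_card; apply/subsetP=> i; rewrite !inE => /andP[].
rewrite nw_countV -[leqRHS]subn0 -(@card_ord_itv n) ?(ltnW (ltn_ord _)) //.
by apply: subset_leq_card; apply/subsetP=> i; rewrite !inE => /andP[].
Qed.

Lemma near_ordE (i : 'I_n) (r a : nat) : (r <= i)%N -> (a <= r)%N ->
  near_ord i r a = (i - r + a)%N :> nat.
Proof.
move=> le_ri le_ar; rewrite /near_ord val_insubd (_ : _ < _)%N //.
by have := ltn_ord i; lia.
Qed.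

Lemma near_increasing (i : 'I_n) (r : nat) : (r <= i)%N ->
  increasing (fun a : 'I_r.+1 => near_ord i r a).
Proof.
move=> le_ri a b lt_ab; have [lta ltb] := (ltn_ord a, ltn_ord b).
by rewrite !near_ordE; lia.
Qed.

Definition on_antidiag c (x : 'I_n * 'I_n) : bool :=
  [&& (c.1 - diag_rank c <= x.1 <= c.1)%N, (c.2 - diag_rank c <= x.2 <= c.2)%N &
      (x.1 + x.2 + diag_rank c == c.1 + c.2)%N].

(** If c' is weakly above c and strictly to its right, the block of c' starts
    to the right of column c.2: by contiguity an earlier start would force the
    one of column c.2 above row c.1, against c being in the diagram.  If c' is
    strictly above c and not to its right, both blocks may overlap, but then
    the antidiagonal of c' runs strictly closer to the north-west corner: the
    rows of the block of c down to row c'.1 have their ones in the block of c,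
    hence either north-west of c' or in the few columns strictly between c'.2
    and c.2, which bounds the rank at c' from below. *)
Lemma antidiag_disjoint c c' x : contiguous -> c \in diagram w -> c' \in diagram w ->
  on_antidiag c x -> on_antidiag c' x -> c = c'.
Proof.
move=> w_cont.
wlog: c c' / ((c'.1 <= c.1) && (c.2 < c'.2) || (c'.1 < c.1) && (c'.2 <= c.2))%N.
  move=> IH Dc Dc' xc xc'; have [//|ne_cc'] := eqVneq c c'.
  have [lt1|lt1] := boolP ((c'.1 <= c.1) && (c.2 < c'.2) || (c'.1 < c.1) && (c'.2 <= c.2))%N.
    exact: IH.
  apply/esym/IH=> //; case: (c) (c') ne_cc' lt1 => [p q] [p' q'] /=.
  by rewrite xpair_eqE -!val_eqE /=; lia.
move=> ltcc' Dc Dc'.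
have [[r1 rowc] [r2 colc]] := (contiguous_rows w_cont Dc, contiguous_cols w_cont Dc).
have [[r1' rowc'] [r2' colc']] := (contiguous_rows w_cont Dc', contiguous_cols w_cont Dc').
have [cw cv] := diagramP Dc; have [cw' cv'] := diagramP Dc'.
move=> /and3P[x1 x2 /eqP x12] /and3P[x1' x2' /eqP x12'].
case/orP: ltcc' => /andP[lt1 lt2].
  by have := colc' c.2; lia.
have rowp' := rowc c'.1; have lt2' : (c'.2 < c.2)%N by lia.
pose S := [set i : 'I_n | (c.1 - diag_rank c <= i < c'.1.+1)%N].
have: (#|S| <= diag_rank c' + (c.2 - c'.2.+1))%N.
  rewrite -(@card_ord_itv n c'.2.+1) ?(ltnW (ltn_ord _)) //.
  rewrite -[X in (_ <= _ + X)%N](card_imset _ (@perm_inj _ (w^-1)%g)).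
  apply: leq_trans (leq_card_setU _ _); apply: subset_leq_card; apply/subsetP => i.
  rewrite !inE => /andP[leS ltS]; have [lewi|ltwi] := leqP (w i) c'.2.
    by rewrite ltS ltnS lewi.
  apply/orP; right; apply/imsetP; exists (w i); rewrite ?permK // inE ltwi.
  by have := rowc i; lia.
by rewrite card_ord_itv //; lia.
Qed.

End Diagram.

(** * Antidiagonal terms of the block minors *)

Section AntidiagonalWeight.
Variable n : nat.
Local Notation box := ('I_n * 'I_n)%type.

(** The sum of i + j over the boxes (i, j) of a term of a block minor does not
    depend on the term, and i + j is constant on the antidiagonal.  The sum of
    (i + j)^2 is therefore smallest there, and the complement to (2n)^2 turns
    this into a maximum over natural numbers. *)
Definition box_weight : 'I_(n * n) -> nat := fun x =>
  mxvec (\matrix_(i < n, j < n) ((2 * n) ^ 2 - (i + j) ^ 2)%N) 0 x.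

Lemma weight_perm_boxes k (g h : 'I_k -> 'I_n) (s : 'S_k) : injective g ->
  weight box_weight (box_mon (perm_boxes g h s)) =
    (\sum_a ((2 * n) ^ 2 - (g a + h (s a)) ^ 2))%N.
Proof.
move=> gI; rewrite /weight /box_mon /perm_boxes -imset_comp.
rewrite (bigID (mem [set (box_var (n:=n) \o (fun a => (g a, h (s a)))) x | x in 'I_k])) /=.
rewrite [X in (_ + X)%N]big1 ?addn0; last by move=> x /negbTE nx; rewrite sqfreeE nx.
rewrite big_imset /=; last by move=> a b _ _ /box_var_inj[/gI].
apply: eq_bigr => a _; rewrite sqfreeE (imset_f (fun a => box_var (g a, h (s a)))) //.
by rewrite mul1n /box_weight /box_var mxvecE mxE.
Qed.

Lemma card_perm_boxes k (g h : 'I_k -> 'I_n) s : injective g -> #|perm_boxes g h s| = k.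
Proof. by move=> gI; rewrite card_imset ?card_ord // => a b [/gI]. Qed.

(** With a fixed sum, a sum of squares is minimal exactly when all terms are
    equal; termwise this is 2xy <= x^2 + y^2. *)
Lemma sum_antidiag_lt k (x : 'I_k -> nat) (y m : nat) :
    (forall a, x a <= m)%N -> (y <= m)%N -> (\sum_a x a = k * y)%N -> (exists a, x a != y) ->
  (\sum_(a < k) (m ^ 2 - x a ^ 2) < \sum_(a < k) (m ^ 2 - y ^ 2))%N.
Proof.
move=> xm ym sum_x [b ne_b].
have le_pt z : (z <= m)%N ->
    (m ^ 2 - z ^ 2 + 2 * y * z <= m ^ 2 - y ^ 2 + 2 * y * y ?= iff (z == y))%N.
  have [le2 <-] := nat_Cauchy z y; rewrite -leq_sqr => zm.
  rewrite -leq_sqr in ym; rewrite -(mulnn y) in ym le2 *.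
  by split; [lia | apply/eqP/eqP; lia].
have: (\sum_(a < k) (m ^ 2 - x a ^ 2 + 2 * y * x a) <
       \sum_(a < k) (m ^ 2 - y ^ 2 + 2 * y * y))%N.
  rewrite (bigD1 b) //= [ltnRHS](bigD1 b) //= -addSn leq_add //.
    by rewrite ltn_neqAle !le_pt ?andbT.
  by apply: leq_sum => a _; rewrite le_pt.
rewrite !big_split /= -big_distrr /= sum_x [X in (_ < _ + X)%N]sum_nat_const card_ord.
by rewrite mulnCA ltn_add2r.
Qed.

End AntidiagonalWeight.

Lemma near_add n (i j : 'I_n) r (a b : 'I_r.+1) : (r <= i)%N -> (r <= j)%N ->
  (near_ord i r a + near_ord j r b = i - r + (j - r) + (a + b))%N.
Proof. by move=> ri rj; rewrite !near_ordE -1?ltnS // addnACA. Qed.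

Lemma near_add_rev n (i j : 'I_n) r (a : 'I_r.+1) : (r <= i)%N -> (r <= j)%N ->
  (near_ord i r a + near_ord j r (rev_ord a) = i + j - r)%N.
Proof.
move=> ri rj; rewrite (near_add _ (rev_ord a)) //= subSS subnKC -1?ltnS //.
by rewrite -addnA subnK // addnBAC.
Qed.

Section BlockMinors.
Variables (K : fieldType) (n : nat) (w : 'S_n).
Local Notation R := {mpoly K[n * n]}.
Local Notation box := ('I_n * 'I_n)%type.
Local Notation X := (generic_mx K n).
Local Notation gen c := (\det (generic_block K w c)).

Definition antidiag_perm k : 'S_k := perm (@rev_ord_inj k).

(** The antidiagonal is presented through a term of the determinant of the
    block, so that the coefficient of its monomial is at hand. *)
Definition antidiag (c : box) : {set box} :=
  perm_boxes (near_ord c.1 (rk K w c)) (near_ord c.2 (rk K w c)) (antidiag_perm (rk K w c).+1).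

Lemma generic_blockE c : generic_block K w c =
  mxsub (near_ord c.1 (rk K w c)) (near_ord c.2 (rk K w c)) X.
Proof. by apply/matrixP => a b; rewrite !mxE. Qed.

Section Box.
Variable c : box.
Hypothesis Dc : c \in diagram w.

Lemma rk_diag : rk K w c = diag_rank w c. Proof. exact: rkE. Qed.

Lemma rk_le : (rk K w c <= c.1)%N /\ (rk K w c <= c.2)%N.
Proof. by rewrite rk_diag; apply: diag_rank_le. Qed.

Lemma near_row_inj : injective (fun a : 'I_(rk K w c).+1 => near_ord c.1 (rk K w c) a).
Proof. by apply/increasing_inj/near_increasing; case: rk_le. Qed.

Lemma near_col_inj : injective (fun a : 'I_(rk K w c).+1 => near_ord c.2 (rk K w c) a).
Proof. by apply/increasing_inj/near_increasing; case: rk_le. Qed.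

Lemma mem_antidiag x : x \in antidiag c -> on_antidiag w c x.
Proof.
case/imsetP => a _ ->; have [r1 r2] := rk_le; rewrite /on_antidiag /= permE -rk_diag.
have lea : (a <= rk K w c)%N by rewrite -ltnS.
by rewrite !near_ordE //=; move: lea r1 r2; lia.
Qed.

Lemma antidiag_neq0 : exists x, x \in antidiag c.
Proof. by eexists; apply: (imset_f _ (x := @ord0 (rk K w c))). Qed.

Lemma mcoeff_block_antidiag : (gen c)@_(box_mon (antidiag c)) != 0.
Proof.
by rewrite generic_blockE mcoeff_minor ?signr_eq0 //; [apply: near_row_inj | apply: near_col_inj].
Qed.

Lemma block_lower m : m \in msupp (gen c) -> m != box_mon (antidiag c) ->
  (mdeg m <= #|antidiag c|)%N /\
  (weight (@box_weight n) m < weight (@box_weight n) (box_mon (antidiag c)))%N.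
Proof.
rewrite mcoeff_msupp generic_blockE => /mcoeff_minor_neq0[|s ->]; first exact: near_row_inj.
rewrite (inj_eq (@box_mon_inj n)) => ne_s; split.
  by rewrite mdeg_sqfree (card_imset _ (@box_var_inj n)) !card_perm_boxes //; apply: near_row_inj.
rewrite !weight_perm_boxes; try exact: near_row_inj.
have [r1 r2] := rk_le; set r := rk K w c in ne_s r1 r2 *.
have antiE (a : 'I_r.+1) :
    (near_ord c.1 r a + near_ord c.2 r (antidiag_perm r.+1 a))%N = (c.1 + c.2 - r)%N.
  by rewrite permE near_add_rev.
rewrite [ltnRHS](eq_bigr (fun=> (2 * n) ^ 2 - (c.1 + c.2 - r) ^ 2)%N); last first.
  by move=> a _; rewrite antiE.
apply: sum_antidiag_lt.
- by move=> a; rewrite mul2n -addnn leq_add // ltnW.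
- by rewrite mul2n -addnn (leq_trans (leq_subr _ _)) // leq_add // ltnW.
- rewrite -[in RHS](card_ord r.+1) -sum_nat_const -[RHS](eq_bigr _ (fun a _ => antiE a)).
  rewrite !big_split /=; congr (_ + _)%N.
  pose F (b : 'I_r.+1) : nat := near_ord c.2 r b.
  rewrite -(reindex_inj (@perm_inj _ s) (P := predT) (F := F)).
  by rewrite -(reindex_inj (@perm_inj _ (antidiag_perm r.+1)) (P := predT) (F := F)).
- apply/existsP; apply: contraR ne_s => /existsPn eq_s; apply/eqP; congr perm_boxes.
  apply/permP => a; apply: val_inj; have := eq_s a; rewrite negbK -(antiE a) => /eqP.
  by rewrite permE !near_add // => /addnI/addnI.
Qed.

Lemma block_minor_schubert : schubert_ideal K w (gen c).
Proof.
apply/schubert_idealE/ideal_gen_mem; have [r1 r2] := rk_le.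
have le_r (a : 'I_(rk K w c).+1) : (a <= rk K w c)%N by rewrite -ltnS.
rewrite generic_blockE; exists c; move: le_r r1 r2; rewrite rkE => le_r r1 r2.
exists (near_ord c.1 (nw_count w c.1.+1 c.2.+1)), (near_ord c.2 (nw_count w c.1.+1 c.2.+1)).
split=> //; try exact: near_increasing.
- by move=> a; rewrite near_ordE //; have := le_r a; lia.
- by move=> a; rewrite near_ordE //; have := le_r a; lia.
Qed.

End Box.

Section Contiguous.
Hypothesis w_cont : contiguous w.
Implicit Types c : {c | c \in diagram w}.

Lemma antidiag_vars_disjoint c c' : c != c' ->
  [disjoint box_var (n:=n) @: antidiag (val c) & box_var (n:=n) @: antidiag (val c')].
Proof.
move=> ne_cc'; rewrite -setI_eq0; apply/set0Pn => -[y]; rewrite inE.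
case/andP=> /imsetP[x xc ->] /imsetP[x' xc' /box_var_inj eq_x]; rewrite -{x'}eq_x in xc'.
case/eqP: ne_cc'; apply: val_inj; apply: (antidiag_disjoint (x := x) w_cont (valP c) (valP c')).
  by apply: mem_antidiag xc; apply: valP.
by apply: mem_antidiag xc'; apply: valP.
Qed.

Lemma schubert_chain_le e : prime_chain (schubert_ideal K w) e -> (e <= n * n - #|diagram w|)%N.
Proof.
have <- : #|{: {c | c \in diagram w}}| = #|diagram w| by rewrite card_sig.
apply: (prime_chain_le (B := fun c => box_var (n:=n) @: antidiag (val c))
  (g := fun c => gen (val c)) (wt := @box_weight n)).
- by move=> c; apply: block_minor_schubert; apply: valP.
- exact: antidiag_vars_disjoint.
- by move=> c; apply: mcoeff_block_antidiag; apply: valP.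
- move=> c m; rewrite (card_imset _ (@box_var_inj n)); apply: block_lower; exact: valP.
Qed.

(** Equal block minors would have equal leading monomials, against the
    disjointness of the antidiagonals. *)
Lemma block_minor_inj : {in diagram w &, injective (fun c : box => gen c)}.
Proof.
move=> c c' Dc Dc' eq_g; have [mc mc'] := (mcoeff_block_antidiag Dc, mcoeff_block_antidiag Dc').
have [eq_m|ne_m] := eqVneq (box_mon (antidiag c)) (box_mon (antidiag c')).
  have [x xc] := antidiag_neq0 c; have xc' : x \in antidiag c' by rewrite -(box_mon_inj eq_m).
  exact: antidiag_disjoint w_cont Dc Dc' (mem_antidiag Dc xc) (mem_antidiag Dc' xc').
rewrite eq_g -mcoeff_msupp in mc; rewrite -eq_g -mcoeff_msupp in mc'.
have [_ lt1] := block_lower Dc' mc ne_m.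
rewrite eq_sym in ne_m; have [_ lt2] := block_lower Dc mc' ne_m.
by have := ltn_trans lt1 lt2; rewrite ltnn.
Qed.

End Contiguous.

End BlockMinors.

(** * Block minors generate the Schubert ideal of a contiguous permutation *)

(** Used in both directions, from the first index and towards the last one,
    this leaves a single increasing map onto an interval of the right size. *)
Lemma increasing_gap k n (g : 'I_k -> 'I_n) d (a b : 'I_k) : increasing g ->
  b = (a + d)%N :> nat -> (g a + d <= g b)%N.
Proof.
move=> g_inc; elim: d b => [|d IHd] b eb.
  by rewrite (_ : a = b) ?addn0 //; apply/val_inj; rewrite /= eb addn0.
have lt_d : (a + d < k)%N by have := ltn_ord b; lia.
have := IHd (Ordinal lt_d) erefl; have := g_inc (Ordinal lt_d) b.
by rewrite eb /=; lia.
Qed.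

Section Generation.
Variables (K : fieldType) (n : nat) (w : 'S_n).
Local Notation R := {mpoly K[n * n]}.
Local Notation box := ('I_n * 'I_n)%type.
Local Notation X := (generic_mx K n).
Local Notation gen c := (\det (generic_block K w c)).

Definition block_minor (f : R) : Prop := exists2 c, c \in diagram w & f = gen c.

Lemma nw_count_row (i : 'I_n) q : (w i < q)%N -> nw_count w i.+1 q = (nw_count w i q).+1.
Proof.
move=> lt_wi; rewrite /nw_count (cardsD1 i) inE ltnSn lt_wi add1n; congr (#|pred_of_set _|.+1).
apply/setP=> x; rewrite !inE; have [->|ne_x] := eqVneq x i; first by rewrite ltnn.
by rewrite -val_eqE in ne_x; rewrite ltnS leq_eqVlt (negbTE ne_x).
Qed.

Lemma nw_count_col (j : 'I_n) p : ((w^-1)%g j < p)%N -> nw_count w p j.+1 = (nw_count w p j).+1.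
Proof.
move=> lt_vj; rewrite !nw_countV (cardsD1 j) inE ltnSn lt_vj add1n; congr (#|pred_of_set _|.+1).
apply/setP=> x; rewrite !inE; have [->|ne_x] := eqVneq x j; first by rewrite ltnn.
by rewrite -val_eqE in ne_x; rewrite ltnS leq_eqVlt (negbTE ne_x).
Qed.

Lemma nw_count_eq0 q p :
  (forall i : 'I_n, (i < p)%N -> (w i < q)%N -> False) -> nw_count w p q = 0%N.
Proof.
move=> none; apply/eqP; rewrite cards_eq0; apply/eqP/setP => i; rewrite !inE.
by apply/negP => /andP[]; apply: none.
Qed.

(** Laplace expansion along a row each of whose terms has a factor in J, be it
    the entry or the complementary minor. *)
Lemma minor_expand_row (J : R -> Prop) k (g h : 'I_k -> 'I_n) a :
    (forall b, J (X (g a) (h b)) \/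
       J (\det (mxsub (g \o lift a) (h \o lift b) X))) ->
  ideal_gen J (\det (mxsub g h X)).
Proof.
move=> JX; rewrite (expand_det_row _ a); apply: ideal_gen_sum => b _.
rewrite mxE; case: (JX b) => JXb.
  by rewrite mulrC; apply/ideal_genM/ideal_gen_mem.
rewrite /cofactor mulrA; apply/ideal_genM/ideal_gen_mem.
by rewrite row'Esub col'Esub -!mxsub_comp.
Qed.

Lemma minor_expand_col (J : R -> Prop) k (g h : 'I_k -> 'I_n) b :
    (forall a, J (X (g a) (h b)) \/
       J (\det (mxsub (g \o lift a) (h \o lift b) X))) ->
  ideal_gen J (\det (mxsub g h X)).
Proof.
move=> JX; rewrite (expand_det_col _ b); apply: ideal_gen_sum => a _.
rewrite mxE; case: (JX a) => JXa.
  by rewrite mulrC; apply/ideal_genM/ideal_gen_mem.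
rewrite /cofactor mulrA; apply/ideal_genM/ideal_gen_mem.
by rewrite row'Esub col'Esub -!mxsub_comp.
Qed.

Lemma increasing_lift k m (g : 'I_k.+1 -> 'I_m) a : increasing g -> increasing (g \o lift a).
Proof.
move=> g_inc x y ltxy; apply: g_inc; change (bump a x < bump a y)%N.
by rewrite /bump; case: leqP; case: leqP; lia.
Qed.

Lemma increasing_max k m (g : 'I_k.+1 -> 'I_m) a : increasing g -> (g a <= g ord_max)%N.
Proof.
move=> g_inc; have [->//|ne_a] := eqVneq a ord_max.
by apply/ltnW/g_inc; rewrite ltn_neqAle -ltnS ltn_ord andbT.
Qed.

Lemma increasing_lift_max k m (g : 'I_k.+1 -> 'I_m) a : increasing g ->
  ((g \o lift ord_max) a < g ord_max)%N.
Proof. by move=> g_inc; apply: g_inc; rewrite lift_max. Qed.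

Hypothesis w_cont : contiguous w.

(** The minors attached to the corner (p, q), by induction on p + q.  A one in
    the last row or column lowers the rank of the neighbouring corner by one,
    exactly the amount by which Laplace expansion lowers the size of a minor.
    Without such ones the corner is a diagram box, and a minor missing its last
    row or column belongs to a neighbour of the same rank.  For the remaining
    minors, the rank is zero just above the block and just to its left, so that
    the entries there are already in the ideal; this leaves only the minor on
    the block itself. *)
Lemma minor_block_ideal p q k (g h : 'I_k -> 'I_n) :
    increasing g -> increasing h ->
    (forall a, g a < p)%N -> (forall a, h a < q)%N -> k = (nw_count w p q).+1 ->
  ideal_gen block_minor (\det (mxsub g h X)).
Proof.
have [N] := ubnP (p + q); elim: N p q k g h => // N IHN p q k.
case: k => [|k] g h // lepq g_inc h_inc g_lt h_lt [ek].
have := g_lt ord_max; case: p lepq g_lt ek => // p lepq g_lt ek.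
have := h_lt ord_max; case: q lepq h_lt ek => // q lepq h_lt ek.
rewrite !ltnS => leh leg; have g_le a := leq_trans (increasing_max a g_inc) leg.
have h_le a := leq_trans (increasing_max a h_inc) leh.
(* beyond the last row or column, neither the count nor the minors change *)
have [lt_pn|ge_pn] := ltnP p n; last first.
  apply: (IHN p q.+1) => //; first by move=> a; apply: leq_trans (ltn_ord _) ge_pn.
  rewrite ek; congr (_.+1); congr #|pred_of_set _|; apply/setP => i; rewrite !inE.
  by have := ltn_ord i; lia.
have [lt_qn|ge_qn] := ltnP q n; last first.
  apply: (IHN p.+1 q) => //; [lia | by move=> a; apply: leq_trans (ltn_ord _) ge_qn |].
  rewrite ek; congr (_.+1); congr #|pred_of_set _|; apply/setP => i; rewrite !inE.
  by have := ltn_ord (w i); lia.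
pose i0 := Ordinal lt_pn; pose j0 := Ordinal lt_qn.
have [wi0|wi0] := ltnP (w i0) q.+1.
  apply/ideal_gen_idem/(minor_expand_row (a := ord_max)) => b; right.
  apply: (IHN p q.+1); try exact: increasing_lift; try lia.
  - by move=> a; apply: leq_trans (increasing_lift_max _ g_inc) leg.
  - by move=> a; apply: h_lt.
  - by rewrite ek (nw_count_row (i := i0)).
have [vj0|vj0] := ltnP ((w^-1)%g j0) p.+1.
  apply/ideal_gen_idem/(minor_expand_col (b := ord_max)) => a; right.
  apply: (IHN p.+1 q); try exact: increasing_lift; try lia.
  - by move=> b; apply: g_lt.
  - by move=> b; apply: leq_trans (increasing_lift_max _ h_inc) leh.
  - by rewrite ek (nw_count_col (j := j0)).
(* from here on the corner is a box of the diagram *)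
have Dc : (i0, j0) \in diagram w by rewrite inE /= wi0 vj0.
have [[r1 rows] [r2 cols]] := (contiguous_rows w_cont Dc, contiguous_cols w_cont Dc).
have rE : diag_rank w (i0, j0) = k by rewrite ek.
rewrite /= rE in r1 r2 rows cols.
have [lt_g|ge_g] := ltnP (g ord_max) p.
  apply: (IHN p q.+1) => //.
    by move=> a; apply: leq_ltn_trans (increasing_max a g_inc) lt_g.
  rewrite ek; congr (_.+1); congr #|pred_of_set _|; apply/setP => i; rewrite !inE.
  by have := diagram_nw i Dc; rewrite /=; lia.
have [lt_h|ge_h] := ltnP (h ord_max) q.
  apply: (IHN p.+1 q) => //; first lia.
    by move=> a; apply: leq_ltn_trans (increasing_max a h_inc) lt_h.
  rewrite ek; congr (_.+1); congr #|pred_of_set _|; apply/setP => i; rewrite !inE.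
  by have := diagram_nw i Dc; rewrite /=; lia.
have [/existsP[a lt_a]|/existsPn all_g] := boolP [exists a, (g a < p - k)%N].
  apply/ideal_gen_idem/(minor_expand_row (a := a)) => b; left.
  rewrite (_ : X _ _ = \det (mxsub (fun _ : 'I_1 => g a) (fun _ : 'I_1 => h b) X)); last first.
    by rewrite det_mx11 [RHS]mxE.
  apply: (IHN (p - k)%N q.+1) => //; try lia; try by move=> [[|//] ?] [[|//] ?].
  rewrite nw_count_eq0 // => i lt_i lt_wi.
  by have := rows i; have := diagram_nw i Dc; rewrite /=; lia.
have [/existsP[b lt_b]|/existsPn all_h] := boolP [exists b, (h b < q - k)%N].
  apply/ideal_gen_idem/(minor_expand_col (b := b)) => a; left.
  rewrite (_ : X _ _ = \det (mxsub (fun _ : 'I_1 => g a) (fun _ : 'I_1 => h b) X)); last first.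
    by rewrite det_mx11 [RHS]mxE.
  apply: (IHN p.+1 (q - k)%N) => //; try lia; try by move=> [[|//] ?] [[|//] ?].
  rewrite nw_count_eq0 // => i lt_i lt_wi.
  by have := cols (w i); rewrite permK; have := diagram_nw i Dc; rewrite /=; lia.
(* all rows and columns of the minor lie in the block *)
have ek' : k = rk K w (i0, j0) by rewrite rk_diag.
clear ek rE; subst k; apply: ideal_gen_mem; exists (i0, j0) => //; rewrite generic_blockE.
congr (\det _); apply/matrixP => a b; rewrite !mxE; congr 'X_(mxvec_index _ _).
- apply/val_inj; rewrite /= near_ordE -1?ltnS //=.
  have := increasing_gap (d := a) g_inc (erefl _ : nat_of_ord a = (@ord0 (rk K w (i0, j0)) + a)%N).
  have := increasing_gap (d := (rk K w (i0, j0) - a)%N) (a := a) (b := ord_max) g_inc.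
  have := all_g ord0; have := ltn_ord a; rewrite /=; lia.
- apply/val_inj; rewrite /= near_ordE -1?ltnS //=.
  have := increasing_gap (d := b) h_inc (erefl _ : nat_of_ord b = (@ord0 (rk K w (i0, j0)) + b)%N).
  have := increasing_gap (d := (rk K w (i0, j0) - b)%N) (a := b) (b := ord_max) h_inc.
  have := all_h ord0; have := ltn_ord b; rewrite /=; lia.
Qed.

Lemma block_minors_generate : generates block_minor (schubert_ideal K w).
Proof.
move=> f; split; last first.
  move=> Jf; apply/schubert_idealE; apply: ideal_gen_trans Jf => _ [c Dc ->].
  by apply/schubert_idealE/block_minor_schubert.
move/schubert_idealE; apply: ideal_gen_trans => _ [c [g [h [g_inc h_inc g_lt h_lt ->]]]].
exact: (minor_block_ideal (p := c.1.+1) (q := c.2.+1)).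
Qed.

End Generation.

(** * A long chain of primes above every Schubert ideal *)

Lemma ker_prime_ideal (A : comNzRingType) (B : idomainType) (f : {rmorphism A -> B}) :
  prime_ideal [pred p : A | f p == 0].
Proof.
split; last by move=> u v; rewrite !inE rmorphM mulf_eq0.
split; rewrite ?inE ?rmorph0 ?rmorph1 ?oner_eq0 //.
by move=> a u v; rewrite !inE rmorphD rmorphM => /eqP-> /eqP->; rewrite mulr0 addr0.
Qed.

(** Both factors can be padded by a zero column, respectively a zero row, to
    square matrices of size #|A|.+1. *)
Lemma det_mulmx_lowrank (R : comNzRingType) (n : nat) (A : {set 'I_n})
    (L : 'M[R]_(#|A|.+1, n)) (U : 'M[R]_(n, #|A|.+1)) :
  (forall a b i, i \notin A -> L a i * U i b = 0) -> \det (L *m U) = 0.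
Proof.
move=> LU0.
pose L' : 'M[R]_(#|A|.+1) :=
  \matrix_(a, b) if unlift ord_max b is Some x then L a (enum_val x) else 0.
pose U' : 'M[R]_(#|A|.+1) :=
  \matrix_(a, b) if unlift ord_max a is Some x then U (enum_val x) b else 0.
have -> : L *m U = L' *m U'.
  apply/matrixP => a b; rewrite !mxE big_ord_recr /= !mxE unlift_none mul0r addr0.
  rewrite (bigID (mem A)) /= [X in _ + X]big1 ?addr0; last by move=> i; apply: LU0.
  rewrite big_enum_val; apply: eq_bigr => x _; rewrite !mxE.
  rewrite (_ : widen_ord _ x = lift ord_max x) ?liftK //.
  by apply: val_inj; rewrite /= /bump leqNgt ltn_ord.
rewrite det_mulmx (expand_det_col _ ord_max) big1 ?mul0r // => a _.
by rewrite mxE unlift_none mul0r.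
Qed.

Section ZeroOut.
Variables (K : fieldType) (N : nat).
Local Notation R := {mpoly K[N]}.

Definition zero_out (S : seq 'I_N) : R -> R :=
  mmap (@mpolyC N K) (fun x => if x \in S then 0 else 'X_x).

HB.instance Definition _ S := GRing.RMorphism.on (zero_out S).

Lemma zero_outX S x : zero_out S 'X_x = if x \in S then 0 else 'X_x.
Proof. by rewrite /zero_out mmapX mmap1U. Qed.

Lemma mpoly_rmorph_ext (B : comNzRingType) (f g : {rmorphism R -> B}) :
  (forall c, f c%:MP = g c%:MP) -> (forall x, f 'X_x = g 'X_x) -> f =1 g.
Proof.
move=> eqC eqX p; rewrite (mpolyE p) !rmorph_sum; apply: eq_bigr => m _.
rewrite -mul_mpolyC !rmorphM /= eqC mpolyXE_id !rmorph_prod; congr (_ * _).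
by apply: eq_bigr => x _; rewrite !rmorphXn /= eqX.
Qed.

Lemma zero_outC S c : zero_out S c%:MP = c%:MP.
Proof. by rewrite /zero_out mmapC. Qed.

Lemma zero_out_comp S T p : {subset S <= T} -> zero_out T (zero_out S p) = zero_out T p.
Proof.
move=> subST; apply: (@mpoly_rmorph_ext _ (zero_out T \o zero_out S) (zero_out T)) => [c|x] /=.
  by rewrite !zero_outC.
rewrite !zero_outX; case: ifP => [/subST->|_]; first by rewrite rmorph0.
by rewrite zero_outX.
Qed.

(** Kernels of successive specializations increase; each strict inclusion is
    witnessed by an element that vanishes only after one more variable has been
    set to zero. *)
Lemma prime_chain_zero_out (A : comNzRingType) (I : A -> Prop) (f : {rmorphism A -> R})
    (xs : seq 'I_N) :
    (forall a, I a -> f a = 0) ->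
    (forall s, (s < size xs)%N -> exists2 a,
       zero_out (take s xs) (f a) != 0 & zero_out (take s.+1 xs) (f a) = 0) ->
  prime_chain I (size xs).
Proof.
move=> fI strict.
exists (fun s => [pred a | (zero_out (take s xs) \o f) a == 0] : {pred A}); split=> [s _|s lt_s].
  by split=> [|a Ia]; [exact: ker_prime_ideal | rewrite inE /= fI // rmorph0].
split=> [a|]; last first.
  by have [a a_n0 a_0] := strict s lt_s; exists a; rewrite inE /= ?a_0.
have sub : {subset take s xs <= take s.+1 xs}.
  by move=> x; rewrite -[take s xs](take_takel _ (leqnSn s)); apply: mem_take.
move=> a_0; rewrite inE /= -(zero_out_comp (f a) sub).
by move: a_0; rewrite inE /= => /eqP->; rewrite rmorph0.
Qed.

End ZeroOut.

Section Parametrization.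
Variables (K : fieldType) (n : nat) (w : 'S_n).
Local Notation R := {mpoly K[n * n]}.
Local Notation box := ('I_n * 'I_n)%type.
Local Notation X := (generic_mx K n).

(** The variable at a box (k, j) outside the diagram serves as the entry (k, j)
    of the upper factor if w k <= j, and otherwise as the entry
    (k, w^-1 j) of the lower factor.  So one polynomial ring in the entries of
    the generic matrix also holds the parameters. *)
Definition lower_mx : 'M[R]_n := \matrix_(k, i)
  ((k == i)%:R + if ((i < k) && (w i < w k))%N then X k (w i) else 0).

Definition upper_mx : 'M[R]_n := \matrix_(i, j) if (w i <= j)%N then X i j else 0.

Definition param : R -> R :=
  mmap (@mpolyC (n * n) K) (fun x => mxvec (lower_mx *m upper_mx) 0 x).

HB.instance Definition _ := GRing.RMorphism.on param.

Lemma paramX i j : param (X i j) = (lower_mx *m upper_mx) i j.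
Proof. by rewrite generic_mxE /param mmapX mmap1U mxvecE. Qed.

(** In a product of p rows of the lower factor by q columns of the upper one,
    only the indices i < p with w i < q contribute, and there are as many of
    these as the rank of w at (p, q). *)
Lemma param_schubert f : schubert_ideal K w f -> param f = 0.
Proof.
have [ker_ideal _] := ker_prime_ideal param.
move=> /schubert_idealE /(ideal_gen_sub_idealr ker_ideal) ker_f.
apply/eqP; move: ker_f; rewrite inE; apply=> {}f; rewrite inE.
move=> [c [g [h [_ _ g_lt h_lt ->]]]]; rewrite -det_map_mx /=.
rewrite (_ : map_mx _ _ = mxsub g id lower_mx *m mxsub id h upper_mx); last first.
  by apply/matrixP => a b; rewrite -mxsub_mul mxE [in LHS]mxE paramX [in RHS]mxE.
apply/eqP/det_mulmx_lowrank => a b i; rewrite !mxE inE negb_and -!ltnNge !ltnS.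
have [lta ltb] := (g_lt a, h_lt b); case/orP => lt_i.
  rewrite -val_eqE /= (_ : (g a == i :> nat) = false) 1?(_ : (i < g a)%N = false) ?addr0 ?mul0r //.
    by lia.
  by lia.
by rewrite (_ : (w i <= h b)%N = false) ?mulr0 //; lia.
Qed.

Definition is_upper (c : box) := (w c.1 <= c.2)%N.

(** Parameters of the lower factor are set to zero first, column by column, and
    those of the upper factor last.  At its turn, the entry of the product at
    the box then reduces to its own parameter, times a parameter of the upper
    factor if the box belongs to the lower one. *)
Definition zero_key (c : box) : nat := if is_upper c then n else c.2.
Definition zero_order : seq box :=
  sort (fun c d => zero_key c <= zero_key d)%N (enum (~: diagram w)).

Lemma zero_order_lt s c0 d : (s < size zero_order)%N -> d \notin diagram w ->
  (zero_key d < zero_key (nth c0 zero_order s))%N -> d \in take s zero_order.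
Proof.
move=> lt_s Ed lt_key; have dz : d \in zero_order by rewrite mem_sort mem_enum inE.
have lt_t : (index d zero_order < size zero_order)%N by rewrite index_mem.
rewrite -[d](nth_index c0 dz); have [lt_ts|le_st] := ltnP (index d zero_order) s.
  by rewrite -(nth_take c0 lt_ts) mem_nth // size_take; case: ifP.
have srt : sorted (fun c d => zero_key c <= zero_key d)%N zero_order.
  by apply: sort_sorted => x y; apply: leq_total.
have tr : transitive (fun c d => zero_key c <= zero_key d)%N by move=> x y z; apply: leq_trans.
have := sorted_leq_nth tr (fun=> leqnn _) c0 srt s (index d zero_order) lt_s lt_t le_st.
by rewrite nth_index // leqNgt lt_key.
Qed.

Lemma zero_order_le s c0 d : (s < size zero_order)%N -> d \in take s.+1 zero_order ->
  (zero_key d <= zero_key (nth c0 zero_order s))%N.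
Proof.
move=> lt_s dT; have srt : sorted (fun c d => zero_key c <= zero_key d)%N zero_order.
  by apply: sort_sorted => x y; apply: leq_total.
have lt_t : (index d zero_order < s.+1)%N by rewrite index_ltn.
have dz := mem_take dT; rewrite -[d](nth_index c0 dz).
apply: (sorted_leq_nth _ _ c0 srt) => //; try by rewrite ?inE ?index_mem.
by move=> x y z; apply: leq_trans.
Qed.

Lemma notin_diagram c : (c \notin diagram w) = (is_upper c || ((w^-1)%g c.2 < c.1)%N).
Proof.
rewrite inE negb_and -!leqNgt /is_upper; have [//|lt_c] := leqP (w c.1) c.2.
rewrite leq_eqVlt; case: eqP => //= /val_inj eq_c.
by rewrite -eq_c permKV ltnn in lt_c.
Qed.

Section Step.
Variable T : seq box.
Local Notation ev := (@zero_out K _ (map (@box_var n) T)).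

Lemma ev_generic (i j : 'I_n) : ev (X i j) = if (i, j) \in T then 0 else X i j.
Proof. by rewrite generic_mxE zero_outX mem_map //; apply: box_var_inj. Qed.

Lemma ev_param (k j : 'I_n) : ev (param (X k j)) =
  \sum_i ((k == i)%:R + (if ((i < k) && (w i < w k))%N then ev (X k (w i)) else 0)) *
         (if (w i <= j)%N then ev (X i j) else 0).
Proof.
rewrite paramX mxE rmorph_sum; apply: eq_bigr => i _.
rewrite !mxE rmorphM rmorphD rmorph_nat; congr ((_ + _) * _); case: ifP => _ //; exact: rmorph0.
Qed.

Lemma ev_param_upper (k j : 'I_n) : (w k <= j)%N ->
    (forall d, d \notin diagram w -> ~~ is_upper d -> d \in T) ->
  ev (param (X k j)) = ev (X k j).
Proof.
move=> wkj lowerT; rewrite ev_param (bigD1 k) //= eqxx ltnn addr0 mul1r wkj big1 ?addr0 //.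
move=> i ne_ik; rewrite eq_sym (negbTE ne_ik) add0r; case: ifP => [|_]; last by rewrite mul0r.
case/andP=> lt_ik lt_w; rewrite ev_generic lowerT ?mul0r //.
  by rewrite notin_diagram /is_upper /= permK lt_ik orbT.
by rewrite /is_upper /= -ltnNge.
Qed.

(** In the sum over i, the terms with w i > j vanish in the upper factor, and
    those with w i < j have been cleared from the lower one. *)
Lemma ev_param_lower (k j : 'I_n) : (j < w k)%N -> ((w^-1)%g j < k)%N ->
    (forall d, d \notin diagram w -> ~~ is_upper d -> (d.2 < j)%N -> d \in T) ->
  ev (param (X k j)) = ev (X k j) * ev (X ((w^-1)%g j) j).
Proof.
move=> jwk vjk lowerT; rewrite ev_param (bigD1 ((w^-1)%g j)) //= permKV leqnn vjk jwk /=.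
rewrite -val_eqE /= (gtn_eqF vjk) add0r big1 ?addr0 // => i ne_i.
have [le_wi|] := leqP (w i) j; last by rewrite mulr0.
have [ek|ne_k] := eqVneq k i; first by rewrite -ek leqNgt jwk in le_wi.
rewrite add0r; case: ifP => [/andP[lt_ik lt_w]|]; last by rewrite mul0r.
have lt_wi : (w i < j)%N.
  rewrite ltn_neqAle le_wi andbT; apply: contraNneq ne_i => /val_inj <-.
  by rewrite permK.
by rewrite ev_generic lowerT ?mul0r // ?notin_diagram /is_upper /= ?permK ?lt_ik ?orbT // -ltnNge.
Qed.

End Step.

Lemma generic_neq0 (i j : 'I_n) : X i j != 0.
Proof. by rewrite generic_mxE -msize_poly_eq0 msizeX. Qed.

Lemma schubert_chain_ge : prime_chain (schubert_ideal K w) (n * n - #|diagram w|).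
Proof.
have sz : size zero_order = (n * n - #|diagram w|)%N.
  rewrite size_sort -cardE -[X in _ = (X * X - _)%N](card_ord n) -card_prod.
  by rewrite -(cardsC (diagram w)) addKn.
rewrite -sz -(size_map (@box_var n)); apply: (prime_chain_zero_out (f := param)).
  exact: param_schubert.
move=> s; rewrite size_map => lt_s; have [c0 _] : exists c0 : box, True.
  by move: lt_s; case: zero_order => // c0 *; exists c0.
pose c := nth c0 zero_order s; exists (X c.1 c.2); rewrite -map_take.
all: have Ec : c \notin diagram w.
all: try by rewrite -in_setC -mem_enum -(mem_sort (fun c d => zero_key c <= zero_key d)%N) mem_nth.
all: have keyT := zero_order_lt (c0 := c0) lt_s; have keyT1 := @zero_order_le s c0 _ lt_s.
all: have uz : uniq zero_order by rewrite sort_uniq enum_uniq.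
all: have cT : c \notin take s zero_order by rewrite in_take_leq ?index_uniq ?ltnn // ltnW.
all: have cT1 : c \in take s.+1 zero_order by rewrite in_take ?mem_nth // index_uniq.
all: have subT d : d \in take s zero_order -> d \in take s.+1 zero_order
  by rewrite -[take s _](take_takel _ (leqnSn s)); apply: mem_take.
all: rewrite -/c in keyT keyT1.
all: have [up|lo] := boolP (is_upper c).
- rewrite ev_param_upper // ?ev_generic -?surjective_pairing ?(negbTE cT) ?generic_neq0 //.
  move=> d Ed lo; apply: keyT => //; rewrite /zero_key up (negbTE lo); exact: ltn_ord.
- have lt_v : ((w^-1)%g c.2 < c.1)%N by move: Ec; rewrite notin_diagram (negbTE lo).
  rewrite ev_param_lower // ?ltnNge //.
    rewrite !ev_generic -surjective_pairing (negbTE cT) mulf_neq0 ?generic_neq0 //.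
    case: ifP => [/subT/keyT1|]; rewrite ?generic_neq0 // /zero_key (negbTE lo).
    by rewrite /is_upper /= permKV leqnn leqNgt ltn_ord.
  by move=> d Ed lo' lt_d; apply: keyT => //; rewrite /zero_key (negbTE lo) (negbTE lo').
- rewrite ev_param_upper // ?ev_generic -?surjective_pairing ?cT1 //.
  move=> d Ed lo; apply/subT/keyT => //; rewrite /zero_key up (negbTE lo); exact: ltn_ord.
- have lt_v : ((w^-1)%g c.2 < c.1)%N by move: Ec; rewrite notin_diagram (negbTE lo).
  rewrite ev_param_lower // ?ltnNge //.
    by rewrite !ev_generic -surjective_pairing cT1 mul0r.
  by move=> d Ed lo' lt_d; apply/subT/keyT => //; rewrite /zero_key (negbTE lo) (negbTE lo').
Qed.

End Parametrization.

(** * A lower bound for the number of generators *)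

Section MinimalGenerators.
Variables (K : fieldType) (N : nat).
Local Notation R := {mpoly K[N]}.

Lemma mcoeffM_lowest (h f : R) m :
    (forall u, (u <= m)%MM -> u != m -> f@_u = 0) ->
  (h * f)@_m = h@_0 * f@_m.
Proof.
move=> f0; rewrite mcoeffM.
have lt0 : (mdeg (0%MM : 'X_{1..N}) < (mdeg m).+1)%N by rewrite mdeg0.
pose p0 : 'X_{1..N < (mdeg m).+1, (mdeg m).+1} := (BMultinom lt0, BMultinom (ltnSn (mdeg m))).
rewrite (bigD1 p0) /= ?add0m // big1 ?addr0 // => -[k1 k2] /= /andP[/eqP em ne0].
have le2 : (bmnm k2 <= m)%MM by apply: lepm_trans (lem_addl k1 _) _; rewrite -em lepm_refl.
have [e2|ne2] := eqVneq (bmnm k2) m; last by rewrite f0 ?mulr0.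
case/eqP: ne0; congr (_, _); apply/val_inj => //=.
by apply: (@addIm _ k2); rewrite add0m -em.
Qed.

(** On an element of J, the coefficient of m i in a product h * f with f in J is
    h(0) times that of f.  So the square matrix of coefficients of the e i, of
    full rank here, factors through the matrix of coefficients of the
    generators. *)
Lemma generated_by_ge (I : finType) (J : R -> Prop) k (m : I -> 'X_{1..N}) (e : I -> R) :
    generated_by k J -> (forall i, J (e i)) ->
    (forall i f u, J f -> (u <= m i)%MM -> u != m i -> f@_u = 0) ->
    (forall i, (e i)@_(m i) != 0) -> (forall i j, i != j -> (e i)@_(m j) = 0) ->
  (#|I| <= k)%N.
Proof.
move=> [gs gsJ] Je J0 ediag eoff.
have Jgs t : J (tnth gs t) by apply/gsJ/ideal_gen_mem/mem_tnth.
pose M := \matrix_(i < #|I|, j < #|I|) (e (enum_val i))@_(m (enum_val j)).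
pose Q := \matrix_(t < k, j < #|I|) (tnth gs t)@_(m (enum_val j)).
have MQ : (M <= Q)%MS.
  apply/row_subP => i; have [s [sgs es]] := (gsJ _).1 (Je (enum_val i)).
  rewrite (_ : row i M = \sum_(t <- s) t.1@_0 *: \row_j t.2@_(m (enum_val j))); last first.
    apply/rowP => j; rewrite !mxE es raddf_sum summxE big_seq [RHS]big_seq /=.
    apply: eq_bigr => t /sgs gst; rewrite !mxE (mcoeffM_lowest _ (m := m (enum_val j))) //.
    by move=> u; apply: J0; apply/gsJ/ideal_gen_mem.
  rewrite big_seq; apply: summx_sub => t /sgs /tnthP[x ->]; apply: scalemx_sub.
  by rewrite (_ : \row_j _ = row x Q) ?row_sub //; apply/rowP => j; rewrite !mxE.
suff: M \in unitmx.
  move/mxrank_unit => rM; rewrite -[X in (X <= _)%N]rM; apply: leq_trans (mxrankS MQ) _.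
  exact: rank_leq_row.
have -> : M = diag_mx (\row_i (e (enum_val i))@_(m (enum_val i))).
  apply/matrixP => i j; rewrite !mxE; have [->|ne_ij] := eqVneq i j; first by rewrite mulr1n.
  by rewrite mulr0n eoff // (inj_eq enum_val_inj).
by rewrite unitmxE det_diag unitfE; apply/prodf_neq0 => i _; rewrite mxE.
Qed.

End MinimalGenerators.

Section Violators.
Variables (K : fieldType) (n : nat) (w : 'S_n).
Local Notation R := {mpoly K[n * n]}.
Local Notation box := ('I_n * 'I_n)%type.
Local Notation X := (generic_mx K n).
Implicit Types (T : {set box}) (c : box) (A : {set 'I_n}) (t : 'S_n).

Definition nw_boxes T c := [set x in T | (x.1 <= c.1)%N && (x.2 <= c.2)%N].

(** The rank of a partial permutation matrix at a corner is its number of ones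
    there, so for such matrices these are the rank conditions of w. *)
Definition admissible T := forall c, (#|nw_boxes T c| <= diag_rank w c)%N.

Lemma box_mon_leP T T' : (box_mon T <= box_mon T')%MM -> T \subset T'.
Proof.
move=> /sqfree_leP le; apply/subsetP => x Tx; have := le _ (imset_f _ Tx).
by rewrite sqfreeE mem_imset; [case: (x \in T') | apply: box_var_inj].
Qed.

(** A term of a generating minor has too many boxes north-west of some corner to
    divide the monomial of an admissible set. *)
Lemma schubert_mcoeff_admissible T f u : admissible T -> schubert_ideal K w f ->
  (u <= box_mon T)%MM -> f@_u = 0.
Proof.
move=> admT /schubert_idealE[s [s_minor ->]] le_u; rewrite raddf_sum big_seq big1 //= => p sp.
have [c [g [h [g_inc h_inc g_lt h_lt ->]]]] := s_minor _ sp.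
rewrite mcoeffM big1 // => -[k1 k2] /= /eqP eu.
have [->|nz] := eqVneq (\det (mxsub g h X))@_k2 0; first by rewrite mulr0.
have [s' ek2] := mcoeff_minor_neq0 (increasing_inj g_inc) nz.
have sub : perm_boxes g h s' \subset T.
  apply: box_mon_leP; rewrite -ek2; apply: lepm_trans le_u.
  by apply: lepm_trans (lem_addl k1 _) _; rewrite -eu lepm_refl.
have := admT c; rewrite leqNgt => /negP[]; rewrite -[X in (X < _)%N]/(nw_count w c.1.+1 c.2.+1).
rewrite -[X in (X <= _)%N](card_ord (nw_count w c.1.+1 c.2.+1).+1).
rewrite -(card_imset _ (_ : injective (fun a => (g a, h (s' a))))); last first.
  by move=> a b [/(increasing_inj g_inc)].
apply: subset_leq_card; apply/subsetP => x Tx; rewrite inE (subsetP sub) //=.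
by case/imsetP: Tx => a _ -> /=; have := g_lt a; have := h_lt (s' a); rewrite !ltnS => -> ->.
Qed.

(** Sets of boxes with at most one box in each row and column are handled as
    partial graphs of permutations. *)
Definition graph A t : {set box} := [set (x, t x) | x in A].

Lemma graph_rows A t : [set x.1 | x in graph A t] = A.
Proof. by rewrite -imset_comp /= imset_id. Qed.

Lemma graph_cols A t : [set x.2 | x in graph A t] = t @: A.
Proof. by rewrite -imset_comp; apply: eq_imset. Qed.

Lemma card_graph A t : #|graph A t| = #|A|.
Proof. by rewrite card_imset // => x y []. Qed.

(** The excess over the rank condition occurs at a corner that encloses the
    whole set, so that the minor on its rows and columns lies in the ideal;
    removing any box repairs all rank conditions. *)
Definition minimal_violator A t : Prop :=
  (exists c, [/\ #|A| = (diag_rank w c).+1, forall x, x \in A -> (x <= c.1)%N &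
                 forall x, x \in A -> (t x <= c.2)%N]) /\
  forall x, x \in A -> admissible (graph (A :\ x) t).

(** The witness is the minor on the rows A and the columns t @: A: each of its
    terms uses all of these rows and columns. *)
Lemma violator_minor A t : minimal_violator A t -> exists f : R,
  [/\ schubert_ideal K w f, f@_(box_mon (graph A t)) != 0 &
      forall A' t', f@_(box_mon (graph A' t')) != 0 -> A' = A /\ t' @: A' = t @: A].
Proof.
move=> [[c [cardA A_row A_col]] _].
have [g [g_inc gA]] := increasing_enum cardA.
have [|h [h_inc hA]] := @increasing_enum n (diag_rank w c).+1 (t @: A).
  by rewrite card_imset //; apply: perm_inj.
have [gI hI] := (increasing_inj g_inc, increasing_inj h_inc).
have gin a : g a \in A by rewrite -gA imset_f.
have hin a : h a \in t @: A by rewrite -hA imset_f.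
exists (\det (mxsub g h X)); split.
- apply/schubert_idealE/ideal_gen_mem; exists c, g, h; split=> // a; rewrite ltnS.
    exact: A_row.
  by case/imsetP: (hin a) => x Ax ->; apply: A_col.
- have /fin_all_exists[s0 s0E] a : exists b, h b = t (g a).
    by have /imsetP[b _ ->] : t (g a) \in [set h b | b in 'I__] by [rewrite hA imset_f]; exists b.
  have s0I : injective s0 by move=> a b eq_s; apply/gI/(@perm_inj _ t); rewrite -!s0E eq_s.
  suff -> : graph A t = perm_boxes g h (perm s0I) by rewrite mcoeff_minor ?signr_eq0.
  rewrite /graph -[in LHS]gA -imset_comp; apply: eq_imset => a /=.
  by rewrite permE s0E.
move=> A' t' /(mcoeff_minor_neq0 gI)[s /box_mon_inj eT].
split; first by rewrite -(graph_rows A' t') eT -gA -imset_comp.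
rewrite -(graph_cols A' t') eT -hA -imset_comp.
apply/setP => x; apply/imsetP/imsetP => -[a _ ->].
  by exists (s a).
by exists ((s^-1)%g a); rewrite //= permKV.
Qed.

Lemma box_mon_proper T u : (u <= box_mon T)%MM -> u != box_mon T ->
  exists2 x, x \in T & (u <= box_mon (T :\ x))%MM.
Proof.
move=> le_u ne_u; have [/existsP[x /andP[Tx ux]]|/existsPn all_n0] :=
    boolP [exists x, (x \in T) && (u (box_var x) == 0%N)].
  exists x => //; apply/mnm_lepP => v; have := mnm_lepP le_u v; rewrite !sqfreeE.
  case/boolP: (v \in _) => [/imsetP[y Ty ->] le1|_]; last by rewrite leqn0 => /eqP->.
  have [->|ne_yx] := eqVneq y x; first by rewrite (eqP ux).
  by rewrite mem_imset ?inE ?ne_yx ?Ty //; apply: box_var_inj.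
case/eqP: ne_u; apply/mnmP => v; apply/eqP; rewrite eqn_leq (mnm_lepP le_u) /=.
rewrite sqfreeE; case/boolP: (v \in _) => // /imsetP[y Ty ->].
by have := all_n0 y; rewrite Ty lt0n.
Qed.

Lemma graphD1 A t x : graph A t :\ (x, t x) = graph (A :\ x) t.
Proof.
apply/setP => -[y z]; rewrite !inE; apply/andP/imsetP => [[ne /imsetP[u Au [ey ez]]]|[u]].
  subst y z.
  by exists u; rewrite // !inE Au andbT; apply: contraNneq ne => ->; rewrite eqxx.
rewrite !inE => /andP[ne_u Au] [-> ->]; split; last exact: imset_f.
by rewrite xpair_eqE (inj_eq (@perm_inj _ t)) andbb.
Qed.

(** Distinct pairs of row set and column set make the minors and the coefficient
    forms dual to each other up to sign. *)
Lemma card_violators_le (I : finType) (A : I -> {set 'I_n}) (t : I -> 'S_n) k :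
    (forall i, minimal_violator (A i) (t i)) ->
    injective (fun i => (A i, t i @: A i)) ->
  generated_by k (schubert_ideal K w) -> (#|I| <= k)%N.
Proof.
move=> viol inj gen_k.
have /fin_all_exists[e eP] i := violator_minor (viol i).
apply: (generated_by_ge (m := fun i => box_mon (graph (A i) (t i))) (e := e) gen_k).
- by move=> i; case: (eP i).
- move=> i f u If le_u ne_u; have [x Tx le_ux] := box_mon_proper le_u ne_u.
  case/imsetP: Tx le_ux => y Ay -> ; rewrite graphD1.
  by apply: schubert_mcoeff_admissible If; case: (viol i) => _; apply.
- by move=> i; case: (eP i).
- move=> i j ne_ij; apply/eqP; apply: contraNT ne_ij => nz.
  by have [_ _ H] := eP i; have [eA et] := H _ _ nz; apply/eqP/inj; rewrite /= et eA.
Qed.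

Lemma nw_countS p q p' q' : (p <= p')%N -> (q <= q')%N -> (nw_count w p q <= nw_count w p' q')%N.
Proof. by move=> lep leq; apply: subset_leq_card; apply/subsetP => i; rewrite !inE; lia. Qed.

(** The injection s moves every box other than the pivot c weakly north-west onto
    a one of w, so rank conditions can fail only at corners that see the
    pivot.  These are south-east of c, where w has rank at least
    diag_rank w c, and one box less is enough. *)
Lemma dominated_violator c A t (s : 'S_n) :
    #|A| = (diag_rank w c).+1 -> c.1 \in A -> t c.1 = c.2 ->
    (forall x, x \in A -> (x <= c.1)%N) -> (forall x, x \in A -> (t x <= c.2)%N) ->
    (forall x, x \in A -> x != c.1 -> (s x <= x)%N /\ (w (s x) <= t x)%N) ->
  minimal_violator A t.
Proof.
move=> cardA Ac tc A_row A_col dom; split; first by exists c.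
move=> x Ax d; have cardAx : #|A :\ x| = diag_rank w c by have := cardsD1 x A; rewrite Ax; lia.
have subT : nw_boxes (graph (A :\ x) t) d \subset graph (A :\ x) t.
  by apply/subsetP => y; rewrite inE => /andP[].
have [/andP[le1 le2]|nle] := boolP ((c.1 <= d.1) && (c.2 <= d.2))%N.
  apply: leq_trans (subset_leq_card subT) _; rewrite card_graph cardAx; exact: nw_countS.
have inj : {in nw_boxes (graph (A :\ x) t) d &, injective (fun y : box => s y.1)}.
  move=> y z /(subsetP subT)/imsetP[y' _ ->] /(subsetP subT)/imsetP[z' _ ->] /= /perm_inj.
  by move=> ->.
rewrite -(card_in_imset inj); apply: subset_leq_card; apply/subsetP => _ /imsetP[y yT ->].
move: yT; rewrite inE => /andP[/imsetP[z]]; rewrite !inE => /andP[_ Az] -> /= /andP[le1 le2].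
have [ez|ne_z] := eqVneq z c.1; first by rewrite -ez -tc -ez le1 le2 in nle.
by have [] := dom z Az ne_z; lia.
Qed.

(** Rows and permutation of the minimal violator attached to a diagram box: the
    transposition redirects the pivot row c.1 to column c.2. *)
Definition diag_rows c : {set 'I_n} := c.1 |: [set i : 'I_n | (i < c.1)%N && (w i < c.2)%N].
Definition diag_perm c : 'S_n := (w * tperm c.2 (w c.1))%g.

Section DiagramBox.
Variable c : box.
Hypothesis Dc : c \in diagram w.

Lemma card_diag_rows : #|diag_rows c| = (diag_rank w c).+1.
Proof. by rewrite cardsU1 inE ltnn add1n diag_rankE. Qed.

Lemma diag_perm_pivot : diag_perm c c.1 = c.2.
Proof. by rewrite permM tpermR. Qed.

Lemma diag_permE x : x \in diag_rows c -> x != c.1 -> diag_perm c x = w x.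
Proof.
rewrite !inE => /orP[/eqP->|/andP[lt_x lt_wx] ne_x]; first by rewrite eqxx.
rewrite permM tpermD //; last by rewrite (inj_eq (@perm_inj _ w)) eq_sym.
by rewrite -val_eqE /= gtn_eqF.
Qed.

Lemma diag_rows_le x : x \in diag_rows c -> (x <= c.1)%N /\ (diag_perm c x <= c.2)%N.
Proof.
move=> Ax; have [->|ne_x] := eqVneq x c.1; first by rewrite diag_perm_pivot.
rewrite diag_permE //; move: Ax; rewrite !inE (negbTE ne_x) /= => /andP[]; lia.
Qed.

Lemma diag_rows_pivot : c.1 \in diag_rows c. Proof. by rewrite !inE eqxx. Qed.

Lemma diag_cols_pivot : c.2 \in diag_perm c @: diag_rows c.
Proof. by rewrite -diag_perm_pivot imset_f // diag_rows_pivot. Qed.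

Lemma diag_violator : minimal_violator (diag_rows c) (diag_perm c).
Proof.
apply: (dominated_violator (c := c) (s := 1%g)).
- exact: card_diag_rows.
- exact: diag_rows_pivot.
- exact: diag_perm_pivot.
- by move=> x /diag_rows_le[].
- by move=> x /diag_rows_le[].
- by move=> x Ax ne_x; rewrite perm1 diag_permE.
Qed.

End DiagramBox.

(** The pivot is recovered as the largest row and the largest column. *)
Lemma diag_supports_inj c A t :
    (c.1 \in A) -> (c.2 \in t @: A) ->
    (forall x, x \in A -> (x <= c.1)%N /\ (t x <= c.2)%N) ->
  forall d, d \in diagram w -> A = diag_rows d -> t @: A = diag_perm d @: diag_rows d -> c = d.
Proof.
move=> Ac tc A_le d Dd eA et.
have d1 : (d.1 <= c.1)%N by case: (A_le d.1); rewrite // eA diag_rows_pivot.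
have c1 : (c.1 <= d.1)%N by case: (diag_rows_le Dd (x := c.1)); rewrite -?eA.
have d2 : (d.2 <= c.2)%N.
  have := diag_cols_pivot d; rewrite -et => /imsetP[x Ax ->]; by case: (A_le x).
have c2 : (c.2 <= d.2)%N.
  move: tc; rewrite et => /imsetP[x Ax ->]; by case: (diag_rows_le Dd (x := x)).
rewrite [c]surjective_pairing [d]surjective_pairing; congr (_, _); apply/val_inj/eqP.
  by rewrite eqn_leq d1 c1.
by rewrite eqn_leq d2 c2.
Qed.

Lemma extra_violator_bound c A t k :
    minimal_violator A t -> c.1 \in A -> c.2 \in t @: A ->
    (forall x, x \in A -> (x <= c.1)%N /\ (t x <= c.2)%N) ->
    ~ (A = diag_rows c /\ t @: A = diag_perm c @: diag_rows c) ->
  generated_by k (schubert_ideal K w) -> (#|diagram w| < k)%N.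
Proof.
move=> viol Ac tc A_le extra gen_k.
pose I := option {d | d \in diagram w}.
have <- : #|{: I}| = #|diagram w|.+1 by rewrite card_option card_sig.
pose A' (i : I) := if i is Some d then diag_rows (val d) else A.
pose t' (i : I) := if i is Some d then diag_perm (val d) else t.
apply: (card_violators_le (A := A') (t := t')) gen_k.
  by case=> [d|] //=; apply: diag_violator; apply: valP.
have no_extra d : d \in diagram w -> A = diag_rows d ->
    t @: A = diag_perm d @: diag_rows d -> False.
  move=> Dd eA et; have ecd := diag_supports_inj Ac tc A_le Dd eA et.
  by apply: extra; rewrite ecd.
case=> [d|] [d'|] //= [eA et].
- congr Some; apply/val_inj; apply: (diag_supports_inj _ _ _ _ eA et).
  + exact: diag_rows_pivot.
  + exact: diag_cols_pivot.
  + by move=> x /(diag_rows_le (valP d)).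
  + exact: valP.
- by case: (no_extra (val d)) => //; exact: valP.
- by case: (no_extra (val d')) => //; exact: valP.
Qed.

(** A gap in the rows at c, that is a row i < c.1 not counted at c below a
    counted row a, gives a further violator: move the one of row a down to row
    i.  A gap in the columns is used in the same way, by moving the one of
    column b right to column j. *)
Lemma few_generators_contiguous k : generated_by k (schubert_ideal K w) ->
  (k <= #|diagram w|)%N -> contiguous w.
Proof.
move=> gen_k; rewrite leqNgt => /negP le_k c Dc; have [cw cv] := diagramP Dc.
split=> [a i lt_ai lt_i lt_wa|b j lt_bj lt_j lt_vb].
  rewrite ltnNge; apply/negP => le_wi; apply: le_k.
  have memA x : (x \in tperm a i @: diag_rows c) = (tperm a i x \in diag_rows c).
    by rewrite -{1}[x](tpermK a i) (mem_imset _ _ (@perm_inj _ _)).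
  pose t := (tperm a i * diag_perm c)%g.
  have tA : t @: (tperm a i @: diag_rows c) = diag_perm c @: diag_rows c.
    by rewrite -imset_comp; apply: eq_imset => x /=; rewrite permM tpermK.
  have ac : a != c.1 by rewrite -val_eqE /=; lia.
  have ic : i != c.1 by rewrite -val_eqE /=; lia.
  have ai : a != i by rewrite -val_eqE /=; lia.
  have Aa : a \in diag_rows c by rewrite !inE lt_wa; lia.
  have nAi : i \notin diag_rows c by rewrite !inE (negbTE ic) /= lt_i ltnNge le_wi.
  have t_pivot : tperm a i c.1 = c.1 by rewrite tpermD.
  have A_pivot : c.1 \in tperm a i @: diag_rows c by rewrite memA t_pivot diag_rows_pivot.
  have A_le x : x \in tperm a i @: diag_rows c -> (x <= c.1)%N /\ (t x <= c.2)%N.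
    rewrite memA => Ax; rewrite [t x]permM; have [le1 le2] := diag_rows_le Dc Ax; split=> //.
    by move: le1; case: tpermP => [->|->|] //; lia.
  apply: (extra_violator_bound (c := c) (A := tperm a i @: diag_rows c) (t := t)) gen_k => //.
  - apply: (dominated_violator (c := c) (s := tperm a i)) => //.
    + by rewrite card_imset ?card_diag_rows //; apply: perm_inj.
    + by rewrite permM t_pivot diag_perm_pivot.
    + by move=> x /A_le[].
    + by move=> x /A_le[].
    + move=> x; rewrite memA => Ax ne_x; rewrite permM.
      have ne_tx : tperm a i x != c.1 by rewrite -t_pivot (inj_eq perm_inj).
      rewrite diag_permE //; split=> //; case: tpermP Ax => [->|->|//]; last by lia.
      by rewrite (negbTE nAi).
  - by rewrite tA diag_cols_pivot.
  - case=> eA _; have : i \in tperm a i @: diag_rows c by rewrite memA tpermR.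
    by rewrite eA (negbTE nAi).
rewrite ltnNge; apply/negP => le_vj; apply: le_k.
pose t := (diag_perm c * tperm b j)%g.
have bc : b != c.2 by rewrite -val_eqE /=; lia.
have jc : j != c.2 by rewrite -val_eqE /=; lia.
have t_pivot : t c.1 = c.2 by rewrite permM diag_perm_pivot tpermD.
have nj x : x \in diag_rows c -> diag_perm c x != j.
  move=> Ax; have [->|ne_x] := eqVneq x c.1; first by rewrite diag_perm_pivot eq_sym.
  rewrite diag_permE //; apply: contraTneq Ax => ewx; rewrite -ewx permK in le_vj.
  by rewrite !inE (negbTE ne_x) /= ltnNge le_vj.
have wle x : x \in diag_rows c -> (diag_perm c x <= t x)%N /\ (t x <= c.2)%N.
  move=> Ax; have [_ le2] := diag_rows_le Dc Ax; have := nj x Ax; rewrite [t x]permM.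
  by case: tpermP => [->|->|]; rewrite ?eqxx //; lia.
apply: (extra_violator_bound (c := c) (A := diag_rows c) (t := t)) gen_k => //.
- apply: (dominated_violator (c := c) (s := 1%g)) => //.
  + exact: card_diag_rows.
  + exact: diag_rows_pivot.
  + by move=> x /(diag_rows_le Dc)[].
  + by move=> x /wle[].
  + by move=> x Ax ne_x; rewrite perm1; case: (wle x Ax); rewrite diag_permE.
- exact: diag_rows_pivot.
- by rewrite -t_pivot imset_f // diag_rows_pivot.
- by move=> x Ax; case: (diag_rows_le Dc Ax); case: (wle x Ax).
- case=> _ et; pose x := (w^-1)%g b.
  have Ax : x \in diag_rows c by rewrite !inE permKV lt_vb; lia.
  have ne_x : x != c.1 by rewrite -val_eqE /= ltn_eqF.
  have : j \in t @: diag_rows c.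
    by apply/imsetP; exists x; rewrite // permM diag_permE // permKV tpermL.
  by rewrite et => /imsetP[y /nj ne_y ey]; rewrite ey eqxx in ne_y.
Qed.

End Violators.

(** * The criterion *)

Section Codimension.
Variables (K : fieldType) (n : nat).
Local Notation R := {mpoly K[n * n]}.

Lemma prime_chain_sub (A : comNzRingType) (I J : A -> Prop) d :
  (forall f, I f -> J f) -> prime_chain J d -> prime_chain I d.
Proof.
move=> IJ [P [pP sP]]; exists P; split=> // k /pP[prP JP]; split=> // f /IJ; exact: JP.
Qed.

(** Degenerate cases of the two bounds: the diagram of the identity is empty,
    which gives its chain of primes full length, and an empty family of
    polynomials gives the upper bound. *)
Lemma mpoly_krull_dim : krull_dim (fun f : R => f = 0) (n * n).
Proof.
split.
  have D0 : diagram (1%g : 'S_n) = set0.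
    by apply/setP => c; rewrite !inE invg1 !perm1; lia.
  have := schubert_chain_ge K (1%g : 'S_n); rewrite D0 cards0 subn0.
  by apply: prime_chain_sub => f ->; apply: ideal_gen0.
move=> e ch; rewrite -[leqRHS]subn0 -(card_void); move: ch.
by apply: (@prime_chain_le K (n * n) void _ (fun=> set0) (fun=> 0) (fun=> 0%N)); case.
Qed.

Lemma schubert_codim_le (w : 'S_n) c :
  has_codim (schubert_ideal K w) c -> (c <= #|diagram w|)%N.
Proof.
move=> [dR [dI [[chR _] [_ maxI] eq_d]]].
have [_ /(_ _ chR) leR] := mpoly_krull_dim.
by have := maxI _ (schubert_chain_ge K w); lia.
Qed.

Lemma contiguous_codim (w : 'S_n) : contiguous w ->
  has_codim (schubert_ideal K w) #|diagram w|.
Proof.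
move=> w_cont; exists (n * n)%N, (n * n - #|diagram w|)%N; split.
- exact: mpoly_krull_dim.
- split; [exact: schubert_chain_ge | exact: schubert_chain_le].
- by rewrite subnK // (leq_trans (max_card _)) // card_prod !card_ord.
Qed.

End Codimension.

Lemma generates_ext (R : comNzRingType) (S T I : R -> Prop) :
  (forall f, S f <-> T f) -> generates S I -> generates T I.
Proof.
move=> ST gS f; split=> [/gS|Tf]; first by apply: ideal_gen_trans => g /ST; apply: ideal_gen_mem.
by apply/gS; apply: ideal_gen_trans Tf => g /ST; apply: ideal_gen_mem.
Qed.

Lemma contiguous_ci (K : fieldType) (n : nat) (w : 'S_n) :
  complete_intersection K w <-> contiguous w.
Proof.
split=> [[c /schubert_codim_le le_c gen_c]|w_cont].
  exact: few_generators_contiguous gen_c le_c.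
exists #|diagram w|; first exact: contiguous_codim.
exists [tuple of [seq \det (generic_block K w c) | c <- enum_tuple (diagram w)]].
apply: (generates_ext _ (@block_minors_generate K _ _ w_cont)) => f; split.
  by move=> [c Dc ->]; apply: map_f; rewrite mem_enum.
by move=> /mapP[c]; rewrite mem_enum => Dc ->; exists c.
Qed.

(** A permutation of rows and columns picked out of w has its diagram inside that
    of w, and contiguity only compares positions. *)
Lemma contiguous_pattern (m n : nat) (v : 'S_m) (w : 'S_n) (rho gamma : 'I_m -> 'I_n) :
    increasing rho -> increasing gamma -> (forall i, w (rho i) = gamma (v i)) ->
  contiguous w -> contiguous v.
Proof.
move=> rho_inc gamma_inc wv w_cont c Dc.
have mono (f : 'I_m -> 'I_n) : increasing f -> forall i j, (f i < f j)%N = (i < j)%N.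
  move=> f_inc i j; apply/idP/idP; last exact: f_inc.
  by apply: contraTT; rewrite -!leqNgt leq_eqVlt => /orP[/eqP/val_inj->//|/f_inc/ltnW].
have wV j : (w^-1)%g (gamma j) = rho ((v^-1)%g j).
  by apply: (@perm_inj _ w); rewrite permKV wv permKV.
have Dc' : (rho c.1, gamma c.2) \in diagram w.
  by move: Dc; rewrite !inE /= wv wV !mono.
have [rows cols] := w_cont _ Dc'; split=> [a i lt_ai lt_ic lt_v|b j lt_bj lt_jc lt_v].
  by have := rows (rho a) (rho i); rewrite /= !wv !mono //; apply.
by have := cols (gamma b) (gamma j); rewrite /= !wV !mono //; apply.
Qed.

Section Blocks.
Variables (K : fieldType) (n : nat) (w : 'S_n).

Lemma nw_blockE (c : 'I_n * 'I_n) a b : nw_block K w c a b =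
  (w (near_ord c.1 (rk K w c) a) == near_ord c.2 (rk K w c) b)%:R.
Proof. by rewrite !mxE. Qed.

Lemma contiguous_block (c : 'I_n * 'I_n) : contiguous w -> c \in diagram w ->
  exists2 v : 'S_(rk K w c), nw_block K w c = perm_mx v & contiguous v.
Proof.
move=> w_cont Dc.
have [[r1 rows] [r2 cols]] := (contiguous_rows w_cont Dc, contiguous_cols w_cont Dc).
rewrite -(rk_diag K) in r1 rows r2 cols; set r := rk K w c in r1 rows r2 cols *.
pose rho (a : 'I_r) := near_ord c.1 r a; pose gamma (a : 'I_r) := near_ord c.2 r a.
have lt_r (a : 'I_r) : (a < r)%N by [].
have rhoE a : rho a = (c.1 - r + a)%N :> nat by rewrite near_ordE // ltnW.
have gammaE a : gamma a = (c.2 - r + a)%N :> nat by rewrite near_ordE // ltnW.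
have lt_rho a : (rho a < c.1)%N by rewrite rhoE; have := lt_r a; lia.
have w_rho a : (c.2 - r <= w (rho a) < c.2)%N.
  have : (c.1 - r <= rho a < c.1)%N by rewrite lt_rho rhoE leq_addr.
  by rewrite -rows => /andP[_ lt_w]; rewrite -cols permK lt_w lt_rho.
have w_lt a : (w (rho a) - (c.2 - r) < r)%N by have := w_rho a; lia.
pose f a := Ordinal (w_lt a).
have wf a : w (rho a) = gamma (f a).
  by apply/val_inj; rewrite /= gammaE /= subnKC //; case/andP: (w_rho a).
have rho_inc : increasing rho by move=> a b; rewrite !rhoE ltn_add2l.
have gamma_inc : increasing gamma by move=> a b; rewrite !gammaE ltn_add2l.
have f_inj : injective f.
  move=> a b eq_f; apply: (increasing_inj rho_inc); apply: (@perm_inj _ w).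
  by rewrite !wf eq_f.
exists (perm f_inj); last first.
  by apply: (contiguous_pattern rho_inc gamma_inc _ w_cont) => a; rewrite permE wf.
apply/matrixP => a b; rewrite nw_blockE [RHS]mxE mxE -/(rho a) -/(gamma b) wf permE.
by rewrite (inj_eq (increasing_inj gamma_inc)).
Qed.

(** A permutation matrix in the block at c has as many ones as the rank at c, so
    these are all the ones strictly north-west of c. *)
Lemma block_contiguous : (forall c : 'I_n * 'I_n, c \in diagram_pos K w ->
    exists v : 'S_(rk K w c), nw_block K w c = perm_mx v) -> contiguous w.
Proof.
move=> block c Dc; have [r1 r2] := rk_le K Dc.
have cardE : #|[set i : 'I_n | (i < c.1)%N && (w i < c.2)%N]| = rk K w c.
  by rewrite rk_diag diag_rankE.
set A := [set i | _] in cardE.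
have [r0|r_gt0] := posnP (rk K w c).
  have none (i : 'I_n) : (i < c.1)%N -> (w i < c.2)%N -> False.
    move=> lt_i lt_wi; have := cards0_eq (etrans cardE r0) => /setP/(_ i).
    by rewrite !inE lt_i lt_wi.
  split=> [a i lt_ai lt_i lt_w|b j lt_bj lt_j lt_w].
    by case: (none a) => //; apply: ltn_trans lt_i.
  by case: (none ((w^-1)%g b)) => //; rewrite permKV; apply: ltn_trans lt_j.
have [|v vE] := block c; first by rewrite inE Dc.
set r := rk K w c in r1 r2 cardE r_gt0 v vE.
pose rho (a : 'I_r) := near_ord c.1 r a; pose gamma (a : 'I_r) := near_ord c.2 r a.
have lt_r (a : 'I_r) : (a < r)%N by [].
have rhoE a : rho a = (c.1 - r + a)%N :> nat by rewrite near_ordE // ltnW.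
have gammaE a : gamma a = (c.2 - r + a)%N :> nat by rewrite near_ordE // ltnW.
have wv a : w (rho a) = gamma (v a).
  apply/eqP; have /matrixP/(_ a (v a)) := vE; rewrite nw_blockE !mxE eqxx.
  by rewrite /rho /gamma; case: (_ == _) => // /eqP; rewrite eq_sym oner_eq0.
have lt_rho a : (rho a < c.1)%N by rewrite rhoE; have := lt_r a; lia.
have lt_gamma a : (gamma a < c.2)%N by rewrite gammaE; have := lt_r a; lia.
have rho_inj : injective rho.
  by move=> a b /(congr1 (@nat_of_ord n)); rewrite !rhoE => /addnI/val_inj.
have rhoA : [set rho a | a in 'I_r] = A.
  apply/eqP; rewrite eqEcard cardE card_imset // card_ord leqnn andbT.
  by apply/subsetP => _ /imsetP[a _ ->]; rewrite inE lt_rho wv lt_gamma.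
split=> [a i lt_ai lt_i lt_w|b j lt_bj lt_j lt_v].
  have /imsetP[x _ ea] : a \in [set rho x | x in 'I_r].
    by rewrite rhoA inE lt_w andbT; apply: ltn_trans lt_i.
  have lt_y : (i - (c.1 - r) < r)%N by move: lt_ai; rewrite ea rhoE; lia.
  rewrite (_ : i = rho (Ordinal lt_y)) ?wv //.
  by apply/val_inj; rewrite /= rhoE /=; move: lt_ai; rewrite ea rhoE; lia.
have /imsetP[x _ eb] : (w^-1)%g b \in [set rho x | x in 'I_r].
  by rewrite rhoA inE permKV lt_v; apply: ltn_trans lt_j.
have {}eb : b = gamma (v x) by rewrite -wv -eb permKV.
have lt_y : (j - (c.2 - r) < r)%N by move: lt_bj; rewrite eb gammaE; lia.
have -> : j = gamma (Ordinal lt_y).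
  by apply/val_inj; rewrite /= gammaE /=; move: lt_bj; rewrite eb gammaE; lia.
have -> : gamma (Ordinal lt_y) = w (rho ((v^-1)%g (Ordinal lt_y))) by rewrite wv permKV.
by rewrite permK.
Qed.

Lemma generic_block_rank0 c : rk K w c = 0%N ->
  \det (generic_block K w c) = generic_mx K n c.1 c.2.
Proof.
rewrite generic_blockE => ->; rewrite det_mx11 [LHS]mxE.
by congr (generic_mx K n _ _); apply/val_inj; rewrite /= near_ordE // subn0 addn0.
Qed.

(** The block of a box of rank zero is the 1 x 1 block at the box, so that the
    variables are block minors as well. *)
Lemma block_minor_fset :
  (var_gens K w `|` det_gens K w)%fset =
  [fset \det (generic_block K w c) | c in diagram w]%fset.
Proof.
apply/fsetP => f; rewrite in_fsetU; apply/orP/imfsetP => [[]/imfsetP[c /=]|[c /= Dc ->]].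
- by rewrite inE => /andP[Dc /eqP r0] ->; exists c; rewrite // generic_block_rank0.
- by rewrite inE => /andP[Dc _] ->; exists c.
have [r0|r_gt0] := posnP (rk K w c); [left|right]; apply/imfsetP; exists c => //=.
- by rewrite inE Dc r0.
- by rewrite generic_block_rank0.
- by rewrite inE Dc r_gt0.
Qed.

Lemma gens_disjoint : contiguous w -> [disjoint var_gens K w & det_gens K w]%fset.
Proof.
move=> w_cont; apply/fdisjointP => f /imfsetP[c /=]; rewrite inE => /andP[Dc /eqP r0] ->.
apply/negP => /imfsetP[d /=]; rewrite inE => /andP[Dd r_gt0].
rewrite -generic_block_rank0 // => /(block_minor_inj w_cont Dc Dd) ecd.
by rewrite -ecd r0 in r_gt0.
Qed.

Lemma card_gens : contiguous w ->
  #|` (var_gens K w `|` det_gens K w)%fset | = #|diagram w|.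
Proof.
move=> w_cont; rewrite block_minor_fset card_in_imfset /=; last exact: block_minor_inj.
by rewrite cardE.
Qed.

End Blocks.

Theorem theorem5p2 (K : fieldType) (n : nat) (w : 'S_n) :
  (complete_intersection K w <->
     forall c : 'I_n * 'I_n, c \in diagram_pos K w ->
       exists2 v : 'S_(rk K w c),
         nw_block K w c = perm_mx v & complete_intersection K v) /\
  (complete_intersection K w ->
     [/\ generates (fun f => f \in (var_gens K w `|` det_gens K w)%fset)
           (schubert_ideal K w),
         [disjoint var_gens K w & det_gens K w]%fset,
         #|` (var_gens K w `|` det_gens K w)%fset | = #|diagram w|
       & has_codim (schubert_ideal K w) #|diagram w| ]).
Proof.
split; last first.
  move=> /contiguous_ci w_cont; split; last exact: contiguous_codim.
  - apply: (generates_ext _ (@block_minors_generate K _ _ w_cont)) => f; rewrite block_minor_fset.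
    split=> [[c Dc ->]|/imfsetP[c /= Dc ->]]; last by exists c.
    by apply/imfsetP; exists c.
  - exact: gens_disjoint.
  - exact: card_gens.
split=> [/contiguous_ci w_cont c|block].
  rewrite inE => /andP[Dc _]; have [v vE v_cont] := contiguous_block K w_cont Dc.
  by exists v; last exact/contiguous_ci.
apply/contiguous_ci/block_contiguous => c /block[v vE _]; by exists v.
Qed.
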